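(* Let $S$ be the minimal Laplacian on $L_2(0,1)$: $\mathcal{D}(S)=\{f\in H^2(0,1): f(0)=f(1)=f'(0)=f'(1)=0\}$, $Sf=-f''$. Let $V$ be the operator of multiplication by a non-trivial non-negative function $V(\cdot)\in L_\infty(0,1)$, let $A=S+\mathrm{i}V$, and let $\widehat A$ be a maximally dissipative extension of $A$. Let $\widehat S=S^*|_{\mathcal{D}(\widehat A)}$, let $\widetilde S=S^*|_{\mathcal{H}_{\mathrm{sym}}(\widehat S)}$ be its symmetric part, and let $W\subseteq\mathcal{H}_{\mathrm{sym}}(\widehat A)$ be a subspace such that $$\mathcal{H}_{\mathrm{sym}}(\widehat A)=\big(\mathcal{D}(\widetilde S)\cap\ker V\big)\dot+W,\qquad W\cap\mathcal{D}(\widetilde S)=W\cap\ker V=\{0\}.$$ Assume that $\dim W=p$. If $$E_V:=\{x\in[0,1]:V(x)>0\}$$ has an interior point, then $\widehat A$ has at most $p$ real eigenvalues counted with multiplicities.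
   Context: $L_2(0,1)$ is complex with inner product linear in the second argument. The adjoint of $S$ is $S^*f=-f''$ with $\mathcal{D}(S^* )=H^2(0,1)$. A densely defined operator $T$ is dissipative if $\operatorname{Im}\langle x,Tx\rangle\ge0$ for all $x\in\mathcal{D}(T)$, and maximally dissipative if it has moreover no non-trivial dissipative extension. It is known that every maximally dissipative extension $\widehat A$ of $A=S+\mathrm{i}V$ ($\mathcal{D}(A)=\mathcal{D}(S)$) satisfies $\mathcal{D}(\widehat A)\subseteq\mathcal{D}(S^* )$ and that $\widehat S:=S^*|_{\mathcal{D}(\widehat A)}$ is a maximally dissipative extension of $S$. For a densely defined operator $T$, $\mathcal{H}_{\mathrm{sym}}(T):=\ker(T-T^* )=\{f\in\mathcal{D}(T)\cap\mathcal{D}(T^* ):Tf=T^*f\}$. The operator $\widetilde S$ with $\mathcal{D}(\widetilde S)=\mathcal{H}_{\mathrm{sym}}(\widehat S)$, $\widetilde Sf=S^*f$, is closed and symmetric. A subspace $W$ with the stated properties always exists and is finite-dimensional, with $p\in\{0,1,2\}$. *)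

(* Defs.v *)
From HB Require Import structures.
From mathcomp Require Import all_boot all_order all_algebra.
From mathcomp Require Import generic_quotient ring_quotient complex.
From mathcomp Require Import all_classical all_reals all_analysis.

Set Implicit Arguments.
Unset Strict Implicit.
Unset Printing Implicit Defensive.

Import Order.TTheory GRing.Theory Num.Theory.
Import numFieldNormedType.Exports.

Local Open Scope classical_set_scope.
Local Open Scope ring_scope.
Local Open Scope complex_scope.

Section L2space.
Context (R : realType).

(* Functions on (0, 1) are represented by functions on the whole line, whose
   values outside of (0, 1) are irrelevant. *)
Definition Lfun01 (p : \bar R) (f : R -> R) : bool :=
  (f \_ `]0, 1[) \in Lfun (@lebesgue_measure R) p.

Definition ae01 (P : R -> Prop) : Prop :=
  {ae @lebesgue_measure R, forall x, `]0, 1[%classic x -> P x}.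

Lemma ae01S2 (P Q S : R -> Prop) :
  (forall x, P x -> Q x -> S x) -> ae01 P -> ae01 Q -> ae01 S.
Proof.
move=> PQS hP hQ.
have F : Filter (almost_everywhere (@lebesgue_measure R)) by exact: ae_filter_ringOfSetsType.
move: hP hQ; apply: (@filterS2 _ _ F).
by move=> x /= PQx1 PQx2 x01; apply: PQS; [exact: PQx1|exact: PQx2].
Qed.

Lemma Lfun01_2_lin a b (f g h : R -> R) :
  Lfun01 2%:E f -> Lfun01 2%:E g -> Lfun01 2%:E h ->
  Lfun01 2%:E (fun x => a * f x + b * g x + h x).
Proof.
have p1 : (1 <= 2%:E :> \bar R)%E by rewrite lee_fin ler1n.
have [L0 LZD] := Lfun_submod_closed (@lebesgue_measure R) p1.
move=> hf hg hh; rewrite /Lfun01.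
have := LZD a _ _ hf (LZD b _ _ hg hh); congr is_true; congr (_ \in Lfun _ _).
apply/funext => x; rewrite /GRing.add /GRing.scale /= /patch.
case: ifP => _; first by rewrite addrA.
by rewrite [LHS](_ : _ = a * 0 + (b * 0 + 0))// !mulr0 !addr0.
Qed.

Lemma Lfun01_2_0 : Lfun01 2%:E (fun=> 0).
Proof.
have p1 : (1 <= 2%:E :> \bar R)%E by rewrite lee_fin ler1n.
have [L0 _] := Lfun_submod_closed (@lebesgue_measure R) p1.
rewrite /Lfun01; move: L0; congr is_true; congr (_ \in Lfun _ _).
by apply/funext => x; rewrite /patch; case: ifP.
Qed.

Definition sqint : {pred R -> R[i]} := fun f =>
  Lfun01 2%:E (fun x => complex.Re (f x)) &&
  Lfun01 2%:E (fun x => complex.Im (f x)).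

Lemma sqint_submod_closed : submod_closed sqint.
Proof.
split => [|a f g /andP[fr fi] /andP[gr gi]].
  by apply/andP; split; exact: Lfun01_2_0.
apply/andP; split.
- have := Lfun01_2_lin (complex.Re a) (- complex.Im a) fr fi gr.
  congr is_true; congr (Lfun01 _ _); apply/funext => x; rewrite /GRing.scale /GRing.add /=.
  by case: a (f x) (g x) => [a b] [c d] [e h]; rewrite /= mulNr.
- have := Lfun01_2_lin (complex.Re a) (complex.Im a) fi fr gi.
  congr is_true; congr (Lfun01 _ _); apply/funext => x; rewrite /GRing.scale /GRing.add /=.
  by case: a (f x) (g x) => [a b] [c d] [e h].
Qed.

HB.instance Definition _ :=
  GRing.isSubmodClosed.Build _ _ sqint sqint_submod_closed.

Record sqfun := SqFun { sqfun_val :> R -> R[i]; _ : sqfun_val \in sqint }.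

HB.instance Definition _ := [isSub for sqfun_val].
HB.instance Definition _ := [Choice of sqfun by <:].
HB.instance Definition _ := [SubChoice_isSubLmodule of sqfun by <:].

Definition ae_zero : {pred sqfun} := fun f =>
  `[< ae01 (fun x => f x = 0) >].

Lemma ae_zero_submod_closed : submod_closed ae_zero.
Proof.
split => [|a f g /asboolP f0 /asboolP g0]; apply/asboolP.
  by apply: aeW => x _; rewrite -[sqfun_val _]/(val _) raddf0.
apply: ae01S2 f0 g0 => x fx gx.
have -> : sqfun_val (a *: f + g) x = a * sqfun_val f x + sqfun_val g x by [].
by rewrite fx gx mulr0 addr0.
Qed.

HB.instance Definition _ :=
  GRing.isSubmodClosed.Build _ _ ae_zero ae_zero_submod_closed.

Local Open Scope quotient_scope.

Definition L2 : Type := Quotient.quot ae_zero.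
HB.instance Definition _ := GRing.Zmodule.on L2.
HB.instance Definition _ := EqQuotient.on L2.

Definition L2scale (a : R[i]) (f : L2) : L2 := \pi_L2 (a *: repr f).

Lemma L2scale_pi a f : L2scale a (\pi_L2 f) = \pi_L2 (a *: f).
Proof.
rewrite /L2scale; apply/eqP.
rewrite -[_ == _]/(_ == _ %[mod Quotient.quot ae_zero]) -Quotient.idealrBE.
rewrite -scalerBr rpredZ// Quotient.idealrBE; apply/eqP; exact: reprK.
Qed.

Lemma L2pi_zmod_morphism : zmod_morphism (\pi_L2 : sqfun -> L2).
Proof. exact: (raddfB (\pi_(Quotient.quot ae_zero))). Qed.

HB.instance Definition _ :=
  GRing.isZmodMorphism.Build sqfun L2 (\pi_L2) L2pi_zmod_morphism.

Lemma L2scaleA a b f : L2scale a (L2scale b f) = L2scale (a * b) f.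
Proof. by rewrite {2}/L2scale L2scale_pi scalerA. Qed.

Lemma L2scale1 : left_id 1 L2scale.
Proof. by move=> f; rewrite /L2scale scale1r reprK. Qed.

Lemma L2scaleDr : right_distributive L2scale +%R.
Proof.
move=> a f g; rewrite -[f]reprK -[g]reprK -raddfD !L2scale_pi scalerDr.
exact: raddfD.
Qed.

Lemma L2scaleDl f : {morph L2scale^~ f : a b / a + b}.
Proof. by move=> a b; rewrite /L2scale scalerDl raddfD. Qed.

HB.instance Definition _ := GRing.Zmodule_isLmodule.Build R[i] L2
  L2scaleA L2scale1 L2scaleDr L2scaleDl.

Definition L2fun (f : L2) : R -> R[i] := repr f.

Lemma L2_eqP (f g : L2) : f = g <-> ae01 (fun x => L2fun f x = L2fun g x).
Proof.
have E : (f == g) = (repr f - repr g \in ae_zero).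
  by rewrite Quotient.idealrBE -[f in LHS]reprK -[g in LHS]reprK.
split=> [->|h]; first by apply: aeW.
apply/eqP; rewrite E; apply/asboolP.
apply: ae01S2 (h) (h) => x; rewrite /L2fun => fg _.
have -> : sqfun_val (repr f - repr g) x = sqfun_val (repr f) x - sqfun_val (repr g) x by [].
by rewrite fg subrr.
Qed.

Definition cintegral (D : set R) (u : R -> R[i]) : R[i] :=
  (\int[lebesgue_measure]_(x in D) complex.Re (u x)) +i*
  (\int[lebesgue_measure]_(x in D) complex.Im (u x)).

Definition dotL2 (f g : L2) : R[i] :=
  cintegral `]0, 1[ (fun x => conjc (L2fun f x) * L2fun g x).

Definition normL2 (f : L2) : R := Num.sqrt (complex.Re (dotL2 f f)).

Definition denseL2 (D : set L2) : Prop :=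
  forall (f : L2) (e : R), 0 < e -> exists2 g, D g & normL2 (f - g) < e.

End L2space.

Coercion L2fun : L2 >-> Funclass.

Section LinearAlgebra.
Context (K : fieldType) (H : lmodType K).

Definition is_subspace (W : set H) : Prop :=
  W 0 /\ forall (a : K) (f g : H), W f -> W g -> W (a *: f + g).

Definition has_dim (W : set H) (n : nat) : Prop :=
  exists b : 'I_n -> H,
    (forall c : 'I_n -> K, \sum_(i < n) c i *: b i = 0 -> forall i, c i = 0) /\
    W = [set f | exists c : 'I_n -> K, f = \sum_(i < n) c i *: b i].

(* X = U (+) W, algebraic (not necessarily orthogonal) direct sum *)
Definition direct_sum (X U W : set H) : Prop :=
  X = [set f + g | f in U & g in W] /\ U `&` W = [set 0].

End LinearAlgebra.

(* Unbounded operators are represented by their graphs, so that an extension is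
   an inclusion. *)
Section Operators.
Context (R : realType).
Local Notation H := (L2 R).
Local Notation graph := (set (H * H)).
Implicit Types (T B : graph) (D : set H).

Definition linear_operator T : Prop :=
  is_subspace T /\ forall f g h, T (f, g) -> T (f, h) -> g = h.

Definition op_dom T : set H := [set f | exists g, T (f, g)].

Definition op_ker T : set H := [set f | T (f, 0)].

Definition op_restrict T D : graph := [set p | T p /\ D p.1].

Definition op_add T B : graph :=
  [set p | exists g h, [/\ T (p.1, g), B (p.1, h) & p.2 = g + h]].

Definition op_scale (a : R[i]) T : graph :=
  [set p | exists2 g, T (p.1, g) & p.2 = a *: g].

(* the graph of an operator as soon as T is densely defined *)
Definition adjoint T : graph :=
  [set p | forall x y, T (x, y) -> dotL2 p.1 y = dotL2 p.2 x].

Definition dissipative T : Prop :=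
  [/\ linear_operator T, denseL2 (op_dom T) &
      forall x y, T (x, y) -> 0 <= complex.Im (dotL2 x y)].

Definition max_dissipative T : Prop :=
  dissipative T /\ forall B, dissipative B -> T `<=` B -> B = T.

Definition Hsym T : set H := [set f | exists g, T (f, g) /\ adjoint T (f, g)].

Definition op_eigenvalue T (l : R[i]) : Prop :=
  exists2 f, f != 0 & T (f, l *: f).

(* the kernel of (T - l)^k, with the natural domain *)
Fixpoint ker_pow T (l : R[i]) (k : nat) : set H :=
  if k is k'.+1 then
    [set f | exists2 g, T (f, g) & ker_pow T l k' (g - l *: f)]
  else [set 0].

Definition root_space T (l : R[i]) : set H := \bigcup_k ker_pow T l k.

(* Multiplicity is algebraic multiplicity, i.e. the dimension of the root space
   (which bounds, and for real eigenvalues of dissipative operators equals, the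
   geometric one). The list s contains each real eigenvalue as often as its
   multiplicity. *)
Definition at_most_real_eigenvalues T (n : nat) : Prop :=
  exists s : seq R,
    [/\ (size s <= n)%N,
        forall l : R, l \in s <-> op_eigenvalue T l%:C &
        forall l : R, l \in s -> has_dim (root_space T l%:C) (count_mem l s)].

End Operators.

Section Laplacian.
Context (R : realType).
Local Notation H := (L2 R).

(* u is absolutely continuous on [0, 1] with derivative v a.e. *)
Definition ac_derivative (u v : R -> R[i]) : Prop :=
  [/\ lebesgue_measure.-integrable `[0, 1] (fun x => (complex.Re (v x))%:E),
      lebesgue_measure.-integrable `[0, 1] (fun x => (complex.Im (v x))%:E) &
      forall x : R, 0 <= x <= 1 -> u x = u 0 + cintegral `[0, x] v].

(* f is in H^2(0,1), where u is the C^1([0,1])-representative of f, u1 is the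
   derivative of u, and f2 is the second (weak) derivative of f. *)
Definition H2_with_derivatives (f : H) (u u1 : R -> R[i]) (f2 : H) : Prop :=
  [/\ ae01 (fun x => f x = u x), ac_derivative u u1 &
      ac_derivative u1 f2].

Definition minimal_laplacian : set (H * H) :=
  [set p | exists u u1 : R -> R[i],
    H2_with_derivatives p.1 u u1 (- p.2) /\
    [/\ u 0 = 0, u 1 = 0, u1 0 = 0 & u1 1 = 0]].

Definition multiplication (V : R -> R) : set (H * H) :=
  [set p : H * H | ae01 (fun x => p.2 x = (V x)%:C * p.1 x)].

End Laplacian.

Arguments minimal_laplacian R _ : clear implicits.

(* Main.v *)
(* An eigenvector f of Ahat for a real eigenvalue l is isotropic for the
   positive semidefinite form Im <x, Ahat y>, so that f lies in the domain of
   the adjoint of Ahat, which acts on it as multiplication by l. Testing against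
   the domain of A shows that f belongs to H^2 and solves - f'' - i V f = l f.
   Let I be an open interval on which V > 0. If Ahat f = g and Ahat^* f = g,
   then - f'' - i V f = g, so g vanishes on I whenever f does. Hence the sums of
   real eigenvectors vanishing on I form an invariant subspace of a
   diagonalizable operator, and are sums of eigenvectors vanishing on I; these
   are zero by unique continuation. Now Hsym(Ahat) = (dom Stilde & ker V) (+) W,
   and the elements of ker V vanish on I, so the span of the real eigenvectors
   embeds into W. *)
Require Import Defs.
From mathcomp Require Import all_boot all_order all_algebra.
From mathcomp Require Import complex.
From mathcomp Require Import all_classical all_reals all_analysis.
From mathcomp Require Import measurable_realfun ess_sup_inf.
From mathcomp Require Import ring lra.

Set Implicit Arguments.
Unset Strict Implicit.
Unset Printing Implicit Defensive.

Import Order.TTheory GRing.Theory Num.Theory.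
Import numFieldNormedType.Exports.

Local Open Scope classical_set_scope.
Local Open Scope ring_scope.
Local Open Scope complex_scope.

(** * Integrable functions on [0, 1] and their primitives *)

Section primitives.
Context (R : realType).
Notation mu := (@lebesgue_measure R).
Implicit Types h k f g : R -> R.

(** Regularity needs no mollifiers: for every square-integrable [k] with zero mean and zero first
    moment, the double primitive of [k] satisfies all four boundary conditions of the minimal
    Laplacian, and testing with such [k] determines a function up to an affine one. Since V is
    merely bounded and measurable, the resulting equation holds only almost everywhere, and V
    couples real and imaginary parts; it is kept as a pair of real integral equations, and
    uniqueness from zero Cauchy data is a Gronwall estimate. The interval I supplies such data: a
    C^1 function vanishing on I has zero derivative there. Nothing bounds the number of real
    eigenvalues in advance, so finite independent families of eigenvectors are counted instead: they
    stay independent modulo the functions vanishing on I, and W spans Hsym(Ahat) modulo these, so no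
    family exceeds p members; a maximal one then exhausts every real eigenspace. *)

Definition integrable01 f := mu.-integrable `[0, 1] (EFin \o f).

Definition continuous01 f := {within `[0, 1], continuous f}.

Definition primitive h (x : R) : R := \int[mu]_(t in `[0, x]) h t.

(** Membership in L2 and inner products are taken over the open interval, primitives and continuity
    over the closed one; this lemma and the next ones move between the two. *)
Lemma measurable_oo_cc (a b : R) f :
  measurable_fun `]a, b[ f <-> measurable_fun `[a, b] f.
Proof.
split.
  by move=> /measurable_fun_itv_obnd_cbndP/measurable_fun_itv_bndo_bndcP.
by move=> /measurable_fun_itv_bndo_bndcP/measurable_fun_itv_obnd_cbndP.
Qed.

Lemma integral_oo_cc (a b : R) (f : R -> R) : measurable_fun `]a, b[ f ->
  (\int[mu]_(x in `]a, b[) (f x)%:E = \int[mu]_(x in `[a, b]) (f x)%:E)%E.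
Proof.
move=> mf; rewrite integral_itv_bndo_bndc ?integral_itv_obnd_cbnd//;
  apply/measurable_EFinP => //.
by apply/measurable_fun_itv_bndo_bndcP.
Qed.

Lemma integrable_oo_cc (a b : R) (f : R -> R) :
  mu.-integrable `]a, b[ (EFin \o f) <-> mu.-integrable `[a, b] (EFin \o f).
Proof.
split=> /integrableP[mf If]; apply/integrableP; split.
- by apply/measurable_EFinP/measurable_oo_cc/measurable_EFinP.
- rewrite (le_lt_trans _ If)// -(@integral_oo_cc a b (Num.norm \o f))//.
  by apply: measurableT_comp => //; apply/measurable_EFinP.
- by apply/measurable_EFinP/measurable_oo_cc/measurable_EFinP.
- rewrite (le_lt_trans _ If)// -(@integral_oo_cc a b (Num.norm \o f))//.
  by apply: measurableT_comp => //; apply/measurable_oo_cc/measurable_EFinP.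
Qed.

Lemma Rintegral_oo_cc f : integrable01 f ->
  \int[mu]_(x in `]0, 1[) f x = \int[mu]_(x in `[0, 1]) f x.
Proof.
move=> /integrable_oo_cc /integrableP[mf _].
by rewrite /Rintegral integral_oo_cc//; apply/measurable_EFinP.
Qed.

Lemma integrable01_le f g : measurable_fun (`[0, 1]%classic : set R) f ->
  (forall x, 0 <= x <= 1 -> `|f x| <= g x) -> integrable01 g -> integrable01 f.
Proof.
move=> mf fg; apply: le_integrable => //; first exact/measurable_EFinP.
move=> x /= x01; by rewrite lee_fin (le_trans (fg _ _)) ?ler_norm//.
Qed.

Lemma integrable01_measurable f : integrable01 f ->
    measurable_fun (`[0, 1]%classic : set R) f.
Proof. by move=> /integrableP[mf _]; apply/measurable_EFinP. Qed.

Lemma integrable01_cont f : continuous01 f -> integrable01 f.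
Proof.
move=> cf; apply: continuous_compact_integrable => //.
exact: segment_compact.
Qed.

Lemma integrable01D f g : integrable01 f -> integrable01 g ->
  integrable01 (fun x => f x + g x).
Proof.
by move=> hf hg; apply: eq_integrable (integrableD _ hf hg).
Qed.

Lemma integrable01B f g : integrable01 f -> integrable01 g ->
  integrable01 (fun x => f x - g x).
Proof.
by move=> hf hg; apply: eq_integrable (integrableB _ hf hg).
Qed.

Lemma integrable01Z (a : R) f : integrable01 f ->
  integrable01 (fun x => a * f x).
Proof.
by move=> hf; apply: eq_integrable (integrableZl _ a hf).
Qed.

Lemma integrable01_norm f : integrable01 f -> integrable01 (fun x => `|f x|).
Proof. by move=> ?; apply: integrable_norm. Qed.

Lemma integrable01_contM f g : continuous01 f ->
  integrable01 g -> integrable01 (fun x => f x * g x).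
Proof.
move=> cf ig.
have mf := integrable01_measurable (integrable01_cont cf).
have bf : [bounded f x | x in `[0, 1]%classic].
  have [c _ fc] := EVT_max ler01 cf; have [d _ fd] := EVT_min ler01 cf.
  exists (Num.max `|f c| `|f d|); split; first exact: num_real.
  move=> M; rewrite gt_max => /andP[cM dM] x x01 /=; rewrite ler_norml.
  rewrite (le_trans _ (fd _ x01)) ?(le_trans (fc _ x01))//.
    by rewrite (le_trans (ler_norm _)) ?ltW.
  by rewrite lerNl (le_trans (ler_norm _))// normrN ltW.
have ifg := @integrableMr _ _ _ mu _ _ f _ mf bf ig.
by apply: eq_integrable (ifg (measurable_itv _)).
Qed.

Lemma primitive_cont h : integrable01 h -> continuous01 (primitive h).
Proof. exact: parameterized_integral_continuous. Qed.

Lemma primitive0 h : primitive h 0 = 0.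
Proof. by rewrite /primitive set_itv1 Rintegral_set1. Qed.

Lemma integrable01S h (x y : R) : integrable01 h -> 0 <= x -> y <= 1 ->
  mu.-integrable `[x, y] (EFin \o h).
Proof.
move=> ih x0 y1; apply: integrableS ih => //.
by apply: subset_itv; rewrite bnd_simp.
Qed.

Lemma primitiveB h (x y : R) : integrable01 h -> 0 <= x -> x <= y -> y <= 1 ->
  primitive h y - primitive h x = \int[mu]_(t in `[x, y]) h t.
Proof.
move=> ih x0 xy y1; rewrite /primitive Rintegral_itvB ?bnd_simp//; last first.
  exact: integrable01S.
rewrite Rintegral_itv_obnd_cbnd//.
apply: (@integrableS _ _ _ mu `[x, y]) => //; first exact: subset_itv_oc_cc.
exact: integrable01S.
Qed.

Lemma primitiveD h k (x : R) : integrable01 h -> integrable01 k -> x <= 1 ->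
  primitive (fun t => h t + k t) x = primitive h x + primitive k x.
Proof.
by move=> ih ik x1; rewrite /primitive RintegralD//; apply: integrable01S.
Qed.

Lemma primitiveZ a h (x : R) : integrable01 h -> x <= 1 ->
  primitive (fun t => a * h t) x = a * primitive h x.
Proof.
by move=> ih x1; rewrite /primitive RintegralZl//; apply: integrable01S.
Qed.

Lemma eq_ae01_integral f g : measurable_fun (`]0, 1[%classic : set R) f ->
    measurable_fun (`]0, 1[%classic : set R) g ->
  ae01 (fun x => f x = g x) ->
  \int[mu]_(x in `]0, 1[) f x = \int[mu]_(x in `]0, 1[) g x.
Proof.
move=> mf mg fg; rewrite /Rintegral; congr fine; apply: ae_eq_integral => //.
- exact/measurable_EFinP.
- exact/measurable_EFinP.
- have F : Filter (almost_everywhere mu) by exact: ae_filter_ringOfSetsType.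
  by move: fg; apply: (@filterS _ _ F) => x fgx x01; rewrite fgx.
Qed.

End primitives.

(** * Integration by parts for primitives of integrable functions *)

Section integration_by_parts.
Context (R : realType).
Notation mu := (@lebesgue_measure R).
Implicit Types h k f g : R -> R.

(** Fubini on the half-plane t <= x, over which both sides integrate h(x) k(t). *)
Lemma Rintegral_triangle h k :
  mu.-integrable setT (EFin \o h) -> mu.-integrable setT (EFin \o k) ->
  \int[mu]_x (h x * \int[mu]_(t in `]-oo, x]) k t) =
  \int[mu]_t (k t * \int[mu]_(x in `[t, +oo[) h x).
Proof.
move=> ih ik.
have mh : measurable_fun setT h by move/integrableP : ih => [/measurable_EFinP].
have mk : measurable_fun setT k by move/integrableP : ik => [/measurable_EFinP].
pose F (z : R * R) := if z.2 <= z.1 then h z.1 * k z.2 else 0.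
have mF : measurable_fun setT F.
  apply: measurable_fun_ifT.
  - by apply: measurable_fun_ler; [exact: measurable_snd|exact: measurable_fst].
  - by apply: measurable_funM; apply: measurableT_comp.
  - exact: measurable_cst.
have Fx x : (\int[mu]_t (F (x, t))%:E =
    (h x * \int[mu]_(t in `]-oo, x]) k t)%:E)%E.
  have ikx : mu.-integrable `]-oo, x] (EFin \o k) by apply: integrableS ik.
  rewrite EFinM fineK; last exact: integrable_fin_num.
  rewrite -integralZl// [in RHS]integral_mkcond; apply: eq_integral => t _.
  by rewrite /patch /F /= mem_setE in_itv/=; case: ifP.
have Ft t : (\int[mu]_x (F (x, t))%:E =
    (k t * \int[mu]_(x in `[t, +oo[) h x)%:E)%E.
  have iht : mu.-integrable `[t, +oo[ (EFin \o h) by apply: integrableS ih.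
  rewrite EFinM fineK; last exact: integrable_fin_num.
  rewrite -integralZl// [in RHS]integral_mkcond; apply: eq_integral => x _.
  rewrite /patch /F /= mem_setE in_itv/= andbT; case: ifP => // _.
  by rewrite mulrC EFinM.
(* The product |h(x)| |k(t)| dominates |F| and has a finite iterated integral. *)
have iF : (mu \x mu)%E.-integrable setT (EFin \o F).
  apply/integrable12ltyP; first exact/measurable_EFinP.
  have hkx x : (\int[mu]_y `|(EFin \o F) (x, y)| <=
      `|h x|%:E * \int[mu]_t `|(k t)%:E|)%E.
    rewrite -ge0_integralZl//=; last exact/measurable_EFinP/measurableT_comp.
    apply: ge0_le_integral => //.
    - apply/measurable_EFinP/measurableT_comp => //.
      exact: (measurableT_comp mF (pair1_measurable x)).
    - apply/measurable_EFinP; apply: measurable_funM => //.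
      exact: measurableT_comp.
    - move=> t _; rewrite /F /= -EFinM lee_fin -normrM; case: ifP => // _.
      by rewrite normr0.
  have [_ ihoo] := integrableP _ _ _ ih; have [_ ikoo] := integrableP _ _ _ ik.
  apply: (@le_lt_trans _ _ (\int[mu]_x (`|h x|%:E * \int[mu]_t `|(k t)%:E|))%E).
    apply: ge0_le_integral => //.
    - by move=> x _; apply: integral_ge0.
    - apply: (@measurable_fun_fubini_tonelli_F _ _ _ _ _ mu
      (fun z => `|(F z)%:E|)%E) => //.
      exact/measurable_EFinP/measurableT_comp.
    - apply: emeasurable_funM => //.
      exact/measurable_EFinP/measurableT_comp.
  rewrite ge0_integralZr//=; last 2 first.
    exact/measurable_EFinP/measurableT_comp.
    exact: integral_ge0.
  by rewrite lte_mul_pinfty// ?integral_ge0// ge0_fin_numE// integral_ge0.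
rewrite /Rintegral; congr fine.
under eq_integral do rewrite -Fx; under [RHS]eq_integral do rewrite -Ft.
exact: (Fubini iF).
Qed.

(** The primitives of merely integrable functions need not be differentiable everywhere, so the
    formula comes from exchanging the order of integration and not from a product rule. *)
Lemma primitive_ibp h k : integrable01 h -> integrable01 k ->
  \int[mu]_(x in `[0, 1]) (h x * primitive k x) =
  primitive h 1 * primitive k 1 - \int[mu]_(x in `[0, 1]) (primitive h x * k x).
Proof.
move=> ih ik.
(* Extension by zero turns the half-line integrals into [primitive k x] and
   [primitive h 1 - primitive h x]. *)
pose r f := f \_ `[0, 1].
have ir f : integrable01 f -> mu.-integrable setT (EFin \o r f).
  by move=> If; rewrite -restrict_EFin; apply/integrable_restrict => //=;
    rewrite setTI.
have rk x : x \in `[0, 1]%classic ->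
    \int[mu]_(t in `]-oo, x]) r k t = primitive k x.
  rewrite inE /= in_itv/= => /andP[x0 x1]; rewrite -Rintegral_mkcondr;
    congr Rintegral.
  apply/seteqP; split=> t /=; rewrite !in_itv/=; first by case=> -> /andP[-> _].
  by move=> /andP[-> tx]; rewrite tx (le_trans tx x1).
have rh x : x \in `[0, 1]%classic ->
    \int[mu]_(t in `[x, +oo[) r h t = primitive h 1 - primitive h x.
  rewrite inE /= in_itv/= => /andP[x0 x1];
    rewrite -Rintegral_mkcondr primitiveB//; congr Rintegral.
  apply/seteqP; split=> t /=; rewrite !in_itv/= andbT; first by case=> ->
    /andP[_ ->].
  by move=> /andP[xt ->]; rewrite xt (le_trans x0 xt).
have := Rintegral_triangle (ir _ ih) (ir _ ik).
have E f g : \int[mu]_x (r f x * g x) = \int[mu]_(x in `[0, 1]) (f x * g x).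
  rewrite [RHS]Rintegral_mkcond; apply: eq_Rintegral => x _.
  by rewrite /r /patch; case: ifP => // _; rewrite mul0r.
rewrite !E => e.
rewrite [LHS](_ : _ = \int[mu]_(x in `[0, 1]) (h x * \int[mu]_(t in `]-oo, x]) r
  k t)); last first.
  by apply: eq_Rintegral => x x01; rewrite rk.
rewrite e [LHS](_ : _ = \int[mu]_(x in `[0, 1])
  (primitive h 1 * k x - primitive h x * k x)).
  rewrite RintegralB//; [|exact: integrable01Z|].
    by rewrite RintegralZl.
  exact: integrable01_contM (primitive_cont _) _.
by apply: eq_Rintegral => x x01; rewrite rh// mulrBr; congr (_ - _);
  exact: mulrC.
Qed.

End integration_by_parts.

(** * Square-integrable functions on the unit interval *)

Section square_integrable.
Context (R : realType).
Notation mu := (@lebesgue_measure R).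
Implicit Types h k f g : R -> R.

Lemma Lfun01_2P f : Lfun01 2%:E f <->
  measurable_fun (`[0, 1]%classic : set R) f /\
  integrable01 (fun x => f x ^+ 2).
Proof.
rewrite /Lfun01; split.
- move=> f2; have /Lfun2_integrable_sqr i2 := f2.
  move: f2; rewrite inE => /andP[/[!inE]/= mf _].
  have mf' : measurable_fun (`[0, 1]%classic : set R) f.
    apply/measurable_oo_cc; apply/(measurable_restrictT _ _).2 => //.
  split => //; apply/integrable_oo_cc; apply/integrable_mkcond => //.
  apply: eq_integrable i2 => // x _; rewrite /patch /=; case: ifP => //=.
  by rewrite expr0n.
- move=> [mf i2].
  have mf0 : measurable_fun setT (f \_ `]0, 1[).
    by apply/(measurable_restrictT _ _).1 => //;
      exact: (measurable_oo_cc 0 1 f).2.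
  apply/andP; split; rewrite inE//= /finite_norm unlock poweR_lty//=.
  move/integrable_oo_cc : i2 => /(integrable_mkcond _ _).1 =>
    /(_ (measurable_itv _)).
  move/integrableP => [_]; apply: le_lt_trans; rewrite le_eqVlt; apply/orP;
    left.
  apply/eqP; apply: eq_integral => x _.
  rewrite /patch /=; case: ifP => //= _; rewrite ?normr0 ?powR0 ?pnatr_eq0//.
  by rewrite powR_mulrn// normrX.
Qed.

Lemma Lfun01_2_integrable f : Lfun01 2%:E f -> integrable01 f.
Proof.
move=> /Lfun01_2P[mf i2].
have i1 : integrable01 (fun=> 1 : R).
  by apply: integrable01_cont; apply: continuous_subspaceT => x;
    exact: cst_continuous.
apply: integrable01_le (integrable01D i1 i2) => // x _.
by rewrite -(@real_normK _ (f x))// ?num_real//; have := normr_ge0 (f x); nra.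
Qed.

Lemma Lfun01_2M_integrable f g : Lfun01 2%:E f -> Lfun01 2%:E g ->
  integrable01 (fun x => f x * g x).
Proof.
move=> /Lfun01_2P[mf f2] /Lfun01_2P[mg g2].
apply: integrable01_le (integrable01D f2 g2) => [|x _].
  exact: measurable_funM.
rewrite ler_norml; apply/andP; split; nra.
Qed.

Lemma Lfun01_2D f g : Lfun01 2%:E f -> Lfun01 2%:E g ->
    Lfun01 2%:E (fun x => f x + g x).
Proof.
move=> hf hg; have := Lfun01_2_lin 1 0 hf hf hg; congr is_true; congr Lfun01.
by apply/funext => x; rewrite mul1r mul0r addr0.
Qed.

Lemma Lfun01_2Z a f : Lfun01 2%:E f -> Lfun01 2%:E (fun x => a * f x).
Proof.
move=> hf; have := Lfun01_2_lin a 0 hf hf (Lfun01_2_0 R); congr is_true;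
  congr Lfun01.
by apply/funext => x; rewrite mul0r !addr0.
Qed.

Lemma Lfun01_2_cont f : continuous01 f -> Lfun01 2%:E f.
Proof.
move=> cf; apply/Lfun01_2P; split.
  exact: integrable01_measurable (integrable01_cont cf).
by apply: integrable01_contM => //; exact: integrable01_cont.
Qed.

Lemma Lfun01_2_bounded (w f : R -> R) (M : R) :
  measurable_fun (`[0, 1]%classic : set R) w -> ae01 (fun x => `|w x| <= M) ->
  Lfun01 2%:E f -> Lfun01 2%:E (fun x => w x * f x).
Proof.
move=> mw wM /Lfun01_2P[mf /integrable_oo_cc if2]; apply/Lfun01_2P.
have mwf : measurable_fun (`[0, 1]%classic : set R) (fun x => w x * f x).
  exact: measurable_funM.
split => //; apply/integrable_oo_cc.
have mwf2 : measurable_fun (`]0, 1[%classic : set R)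
    (fun x => (w x * f x) ^+ 2).
  by apply: measurable_funX; exact/measurable_oo_cc.
apply/integrableP; split; first exact/measurable_EFinP.
have := integrableZl _ (M ^+ 2) if2.
move=> /(_ (measurable_itv _))/integrableP[_].
apply: le_lt_trans; apply: ae_ge0_le_integral => //.
- exact/measurable_EFinP/measurableT_comp.
- apply/measurable_EFinP/measurableT_comp => //; apply: measurable_funM => //.
  by apply: measurable_funX; exact/measurable_oo_cc.
- have F : Filter (almost_everywhere mu) by exact: ae_filter_ringOfSetsType.
  move: wM; apply: (@filterS _ _ F) => x + x01 => /(_ x01) wM /=.
  rewrite lee_fin exprMn !normrM ler_wpM2r ?mulr_ge0//.
  by rewrite ler_pM// (le_trans wM)// ler_norm.
Qed.

Lemma Rintegral01_exprn n :
  \int[mu]_(x in `[0, 1]) x ^+ n = n.+1%:R^-1 :> R.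
Proof.
(* The integral of x^n is the Beta value B(n+1, 1) = n! 0! / (n+1)!. *)
have := @beta_fun_fact R n 0; rewrite /beta_fun /= addn0 muln1.
rewrite -Rintegral_mkcond => e.
transitivity (n`!%:R / n.+1`!%:R : R).
  by rewrite -e; apply: eq_Rintegral => x _; rewrite XMonemXn0.
by rewrite factS natrM invfM mulrCA divff ?mulr1// pnatr_eq0 -lt0n fact_gt0.
Qed.

Lemma integrable01_ae0 f : integrable01 f -> (forall x, 0 <= f x) ->
  \int[mu]_(x in `[0, 1]) f x = 0 -> ae01 (fun x => f x = 0).
Proof.
move=> iF f0; rewrite -Rintegral_oo_cc// => If0.
have iF' : mu.-integrable `]0, 1[ (EFin \o f) by exact/integrable_oo_cc.
have : (\int[mu]_(x in `]0%R, 1%R[) (f x)%:E = 0)%E.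
  rewrite -[LHS]fineK -/(Rintegral mu `]0, 1[ f) ?If0//.
  by have := integrable_fin_num _ iF'; exact.
rewrite (_ : (\int[mu]_(x in _) _ = \int[mu]_(x in `]0%R, 1%R[) `|(f x)%:E|)%E);
  last first.
  by apply: eq_integral => x _; rewrite /= ger0_norm.
move/ae_eq_integral_abs => H.
have := H (measurable_itv _) (measurable_int _ iF').
have F : Filter (almost_everywhere mu) by exact: ae_filter_ringOfSetsType.
by apply: (@filterS _ _ F) => x + x01 => /(_ x01)[].
Qed.

End square_integrable.

(** * Weak second derivatives *)

Section weak_derivative.
Context (R : realType).
Notation mu := (@lebesgue_measure R).
Implicit Types h k f g : R -> R.

Lemma continuous01_cst (a : R) : continuous01 (fun=> a : R).
Proof. by apply: continuous_subspaceT => x; exact: cst_continuous. Qed.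

Lemma continuous01_id : continuous01 (fun x : R => x).
Proof. by apply: continuous_subspaceT => x; exact: cvg_id. Qed.

Lemma continuous01D f g : continuous01 f ->
  continuous01 g -> continuous01 (fun x => f x + g x).
Proof. by move=> cf cg x; exact: (continuousD (cf x) (cg x)). Qed.

Lemma continuous01M f g : continuous01 f ->
  continuous01 g -> continuous01 (fun x => f x * g x).
Proof. by move=> cf cg x; exact: (continuousM (cf x) (cg x)). Qed.

Lemma continuous01_norm f : continuous01 f ->
  continuous01 (fun x => `|f x|).
Proof.
by move=> cf x; apply: cvg_norm; exact: cf.
Qed.

(** Parts against the constant 1, whose primitive is x. The two conditions at 1 imposed on test
    functions thus say that they are orthogonal to 1 and x. *)
Lemma primitive_primitive h : integrable01 h ->
  primitive (primitive h) 1 = primitive h 1 - primitive (fun x => x * h x) 1.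
Proof.
move=> ih; have i1 := integrable01_cont (@continuous01_cst 1).
have p1 x : 0 <= x <= 1 -> primitive (fun=> 1 : R) x = x.
  move=> /andP[x0 x1]; rewrite /primitive Rintegral_cst//=
    lebesgue_measure_itv/= lte_fin.
  by case: ltgtP x0 => //= [_ _|<- _]; rewrite mul1r ?subr0.
have := primitive_ibp i1 ih.
rewrite p1 ?ler01 ?lexx// mul1r => e.
rewrite {1}/primitive; under eq_Rintegral do rewrite -[primitive h _]mul1r.
rewrite e; congr (_ - _); apply: eq_Rintegral => x /[!inE] x01.
by rewrite p1.
Qed.

(* The coefficients of the affine part are those of the L2-projection of
   phi - primitive (primitive h) onto the affine functions. *)
Lemma weak_second_derivative (phi h : R -> R) :
  Lfun01 2%:E phi -> integrable01 h ->
  (forall k, Lfun01 2%:E k -> primitive k 1 = 0 ->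
    primitive (primitive k) 1 = 0 ->
     \int[mu]_(x in `[0, 1]) (phi x * k x) =
     \int[mu]_(x in `[0, 1]) (h x * primitive (primitive k) x)) ->
  exists a b, ae01 (fun x => phi x = a + b * x + primitive (primitive h) x).
Proof.
move=> phi2 ih weak.
have cPh := primitive_cont ih.
have cPPh := primitive_cont (integrable01_cont cPh).
pose psi x := phi x + (-1) * primitive (primitive h) x.
have psi2 : Lfun01 2%:E psi by apply: Lfun01_2D => //; apply: Lfun01_2Z;
    exact: Lfun01_2_cont.
have c1 := @continuous01_cst 1; have cx := continuous01_id.
pose m0 := primitive psi 1; pose m1 := primitive (fun x => x * psi x) 1.
(* The moments of a + b x are a + b/2 and a/2 + b/3; the numbers 4, 6, 12 are the entries, up to
   sign, of the inverse of this Hilbert matrix. *)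
pose a := 4 * m0 - 6 * m1; pose b := 12 * m1 - 6 * m0.
pose aff x := a + b * x.
have caff : continuous01 aff.
  by apply: continuous01D; [exact: continuous01_cst|apply: continuous01M => //;
    exact: continuous01_cst].
pose k x := psi x + (-1) * aff x.
have k2 : Lfun01 2%:E k by apply: Lfun01_2D => //; apply: Lfun01_2Z;
    exact: Lfun01_2_cont.
have ik := Lfun01_2_integrable k2.
have ipsi := Lfun01_2_integrable psi2.
have ik1 := integrable01_contM cx ik.
have iaff := integrable01_cont caff.
have ixpsi := integrable01_contM cx ipsi.
have ixaff := integrable01_contM cx iaff.
have i1 := integrable01_cont c1; have ix := integrable01_cont cx.
have ixx := integrable01_contM cx ix.
have E1 : primitive (fun=> 1) 1 = 1 :> R.
  by rewrite -[RHS](invr1) -(Rintegral01_exprn R 0); apply: eq_Rintegral.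
have Ex : primitive (fun x => x) 1 = 2^-1 :> R.
  by rewrite -(Rintegral01_exprn R 1); apply: eq_Rintegral.
have Exx : primitive (fun x => x * x) 1 = 3^-1 :> R.
  by rewrite -(Rintegral01_exprn R 2); apply: eq_Rintegral.
have affE : primitive aff 1 = a + b / 2.
  rewrite primitiveD//; last exact: integrable01Z.
    rewrite primitiveZ// Ex; congr (_ + _).
    by rewrite -[RHS]mulr1 -[X in _ = a * X]E1 -primitiveZ//;
      apply: eq_Rintegral => x _; rewrite mulr1.
  exact: integrable01_cont (@continuous01_cst a).
have xaffE : primitive (fun x => x * aff x) 1 = a / 2 + b / 3.
  rewrite -Ex -Exx -!primitiveZ// -primitiveD//; last 2 first.
    exact: integrable01Z.
    exact: integrable01Z.
  by apply: eq_Rintegral => x _; rewrite /aff; ring.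
have Pk : primitive k 1 = 0.
  rewrite primitiveD//; last exact: integrable01Z.
  by rewrite primitiveZ// affE -/m0 /a /b; field.
have Pxk : primitive (fun x => x * k x) 1 = 0.
  rewrite (_ : primitive _ 1 = primitive
    (fun x => x * psi x + (-1) * (x * aff x)) 1).
    rewrite primitiveD//; last exact: integrable01Z.
    by rewrite primitiveZ// xaffE -/m1 /a /b; field.
  by apply: eq_Rintegral => x _; rewrite /k; ring.
have PPk : primitive (primitive k) 1 = 0.
  by rewrite primitive_primitive// Pk Pxk subr0.
(* Now [k] is itself an admissible test function. Two integrations by parts move both primitives
   from [k] onto [h], and the boundary terms vanish. *)
have ortho : primitive (fun x => psi x * k x) 1 = 0.
  have := weak _ k2 Pk PPk.
  rewrite (primitive_ibp ih (integrable01_cont (primitive_cont ik))) PPk mulr0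
    sub0r.
  rewrite (primitive_ibp (integrable01_cont cPh) ik) Pk mulr0 sub0r opprK => e.
  rewrite (_ : primitive _ 1 = primitive (fun x => phi x * k x +
     (-1) * (primitive (primitive h) x * k x)) 1).
    rewrite primitiveD//; [|exact: Lfun01_2M_integrable|].
      rewrite primitiveZ// 1?mulN1r 1?[X in X - _ = _]e ?subrr//.
      exact: integrable01_contM.
    by apply: integrable01Z; exact: integrable01_contM.
  by apply: eq_Rintegral => x _; rewrite /psi; ring.
(* Here k = psi - aff, and [k] is orthogonal both to psi and to affine functions. *)
have kk0 : primitive (fun x => k x * k x) 1 = 0.
  rewrite (_ : primitive _ 1 = primitive (fun x => psi x * k x +
     ((- a) * k x + (- b) * (x * k x))) 1).
    rewrite primitiveD//; [|exact: Lfun01_2M_integrable|]; last first.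
      by apply: integrable01D; apply: integrable01Z.
    rewrite ortho primitiveD//; [|exact: integrable01Z..].
    by rewrite !primitiveZ// Pk Pxk; ring.
  by apply: eq_Rintegral => x _; rewrite {1}/k /aff; ring.
have ikk : integrable01 (fun x => k x * k x) by exact: Lfun01_2M_integrable.
exists a, b; have kae := integrable01_ae0 ikk (fun x => sqr_ge0 (k x)) kk0.
apply: ae01S2 (kae) (kae) => x /eqP; rewrite mulf_eq0 orbb => /eqP + _.
by rewrite /k /psi /aff => e; apply/eqP; rewrite -subr_eq0 -[X in _ == X]e;
  apply/eqP; ring.
Qed.

End weak_derivative.

(** * Unique continuation *)

Section ode.
Context (R : realType).
Notation mu := (@lebesgue_measure R).
Implicit Types h k f g : R -> R.

Lemma continuous01_at f (x : R) : continuous01 f -> 0 < x < 1 ->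
    {for x, continuous f}.
Proof.
by move=> cf x01; have [+ _ _] := (continuous_within_itvP f ltr01).1 cf; apply.
Qed.

Lemma primitive_derive h (x : R) : continuous01 h -> 0 < x < 1 ->
  is_derive x 1 (primitive h) (h x).
Proof.
move=> ch /[dup] x01 /andP[x0 x1].
have [] := continuous_FTC1_closed x1 (integrable01_cont ch) x0
    (continuous01_at ch x01).
by move=> dP <-; rewrite derive1E; exact: derivableP.
Qed.

(* Every C^1 function on [0, 1] with absolutely continuous derivative has this
   form, h being its second derivative. *)
Definition affine_primitive2 (a b : R) h (x : R) :=
    a + b * x + primitive (primitive h) x.

Lemma affine_primitive2_cont a b h : integrable01 h ->
    continuous01 (affine_primitive2 a b h).
Proof.
move=> ih; apply: continuous01D; last
  exact/primitive_cont/integrable01_cont/primitive_cont.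
apply: continuous01D; first exact: continuous01_cst.
by apply: continuous01M; [exact: continuous01_cst|exact: continuous01_id].
Qed.

Lemma affine_primitive2_derive a b h (x : R) : integrable01 h -> 0 < x < 1 ->
  is_derive x 1 (affine_primitive2 a b h) (b + primitive h x).
Proof.
move=> ih x01; have dPP := primitive_derive (primitive_cont ih) x01.
rewrite /affine_primitive2.
by apply: is_derive_eq; rewrite /GRing.scale /=; ring.
Qed.

(** A nonzero value would persist on a ball, which has positive measure. *)
Lemma continuous_ae_eq0 f (c d : R) :
    (forall x, c < x < d -> {for x, continuous f}) ->
  {ae mu, forall x, c < x < d -> f x = 0} -> forall x, c < x < d -> f x = 0.
Proof.
move=> cf [N [mN N0 fN]] x xcd; apply/eqP/negPn/negP => fx0.
have : \forall y \near x, c < y < d /\ f y != 0.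
  near=> y; split; near: y.
    have oy : open_nbhs x `]c, d[%classic by split; [exact: interval_open|].
    exact: filterS (open_nbhs_nbhs oy).
  exact: cvgr_neq0 (cf x xcd) fx0.
move=> [e /= e0 xe].
have : mu (ball x e) = 0%E.
  apply: subset_measure0 N0 => //; first exact: measurable_ball.
  move=> y /xe [ycd fy]; apply: fN => /=.
  by move=> /(_ ycd) fy0; rewrite fy0 eqxx in fy.
rewrite lebesgue_measure_ball// ?ltW// => /eqP; rewrite eqe mulrn_eq0 /=.
by rewrite gt_eqF.
Unshelve. all: by end_near. Qed.

(** Lebesgue differentiation: almost everywhere [h] is the derivative of its primitive, which is
    locally constant here. *)
Lemma primitive_cst_ae0 h (c d e : R) : integrable01 h -> 0 <= c -> d <= 1 ->
  (forall x, c < x < d -> primitive h x = e) ->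
    ae01 (fun x => c < x < d -> h x = 0).
Proof.
move=> ih c0 d1 he.
pose r := h \_ `[0, 1].
have ir : mu.-integrable setT (EFin \o r).
  by rewrite -restrict_EFin; apply/integrable_restrict => //=; rewrite setTI.
have lr : locally_integrable setT r.
  by apply: open_integrable_locally => //; exact: openT.
have iry y : mu.-integrable `[0, y] (EFin \o r) by apply: integrableS ir.
have := @FTC1 _ r (BLeft 0) iry lr.
have F : Filter (almost_everywhere mu) by exact: ae_filter_ringOfSetsType.
apply: (@filterS _ _ F) => x + x01 /andP[cx xd].
have x0 : 0 < x by rewrite (le_lt_trans c0).
have x1 : x < 1 by rewrite (lt_le_trans xd).
move=> /(_ x0)[_]; rewrite {2}/r patchE mem_set => [|/=]; last first.
  by rewrite in_itv/= !ltW.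
move=> <-; rewrite derive1E -[RHS](derive_cst e x (1 : R)).
apply: near_eq_derive.
near=> y.
have /andP[cy yd] : c < y < d.
  near: y; have oy : open_nbhs x `]c, d[%classic.
    by split; [exact: interval_open|rewrite /= in_itv/= cx].
  exact: filterS (open_nbhs_nbhs oy).
rewrite -[RHS](he y) ?cy//; apply: eq_Rintegral => z /[!inE] /=.
rewrite in_itv/= => /andP[z0 zy]; rewrite /r patchE mem_set//= in_itv/= z0.
by rewrite (le_trans zy)// (le_trans _ d1)// ltW.
Unshelve. all: by end_near. Qed.

(** Continuity upgrades vanishing almost everywhere to vanishing everywhere; one classical and one
    Lebesgue differentiation follow. The pointwise part later yields Cauchy data, the other one the
    vanishing of the right-hand side of the equation. *)
Lemma affine_primitive2_eq0 a b h (c d : R) :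
  integrable01 h -> 0 <= c -> d <= 1 ->
  ae01 (fun x => c < x < d -> affine_primitive2 a b h x = 0) ->
  (forall x, c < x < d ->
    affine_primitive2 a b h x = 0 /\ b + primitive h x = 0) /\
  ae01 (fun x => c < x < d -> h x = 0).
Proof.
move=> ih c0 d1 Fae.
have sub x : c < x < d -> 0 < x < 1.
  by move=> /andP[cx xd]; rewrite (le_lt_trans c0)// (lt_le_trans xd).
have F0 : forall x, c < x < d -> affine_primitive2 a b h x = 0.
  apply: continuous_ae_eq0 => [x /sub x01|].
    by apply: continuous01_at x01; exact: affine_primitive2_cont.
  have F : Filter (almost_everywhere mu) by exact: ae_filter_ringOfSetsType.
  by move: Fae; apply: (@filterS _ _ F) => x + xcd; apply => //=;
    rewrite in_itv/= sub.
have D0 x : c < x < d -> b + primitive h x = 0.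
  move=> xcd; have dF := affine_primitive2_derive a b ih (sub _ xcd).
  rewrite -(@derive_val _ _ _ _ _ _ _ dF) -[RHS](derive_cst (0 : R) x (1 : R)).
  apply: near_eq_derive; near=> y; apply: F0.
  near: y; have oy : open_nbhs x `]c, d[%classic.
    by split; [exact: interval_open|].
  exact: filterS (open_nbhs_nbhs oy).
split=> [x xcd|]; first by split; [exact: F0|exact: D0].
apply: (primitive_cst_ae0 (e := - b) ih c0 d1) => x xcd.
by apply/eqP; rewrite -addr_eq0 addrC D0.
Unshelve. all: by end_near. Qed.

End ode.

(** * Gronwall estimates and uniqueness from zero Cauchy data *)

Section gronwall.
Context (R : realType).
Notation mu := (@lebesgue_measure R).
Implicit Types f g h : R -> R.

Lemma MVT01 f g (s t : R) :
  (forall x : R, 0 < x < 1 -> is_derive x 1 f (g x)) ->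
  0 < s -> s <= t -> t < 1 ->
  exists2 x, s <= x <= t & f t - f s = g x * (t - s).
Proof.
move=> df s0 st t1.
have df' x : x \in `[s, t] -> is_derive x 1 f (g x).
  by rewrite in_itv/= => /andP[sx xt]; apply: df;
    rewrite (lt_le_trans s0)// (le_lt_trans xt).
have cf : {within `[s, t], continuous f}.
  by apply: derivable_within_continuous => x /df' h; exact: ex_derive.
have [x xst fx] :=
  MVT_segment st (fun x xst => df' x (subset_itv_oo_cc xst)) cf.
by exists x.
Qed.

Lemma gronwall0 f g (C m : R) :
  (forall x : R, 0 < x < 1 -> is_derive x 1 f (g x)) ->
  (forall x : R, 0 < x < 1 -> `|g x| <= C * `|f x|) ->
  0 < m < 1 -> f m = 0 -> forall t : R, 0 < t < 1 -> f t = 0.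
Proof.
move=> df gf m01 fm t t01.
(* The weight makes f^2 exp(K x) monotone: nonincreasing for K = -2C, used to the right of m, and
   nondecreasing for K = 2C, used to the left. Either way its value at t is at most its value 0 at
   m. *)
pose y (K x : R) := f x ^+ 2 * expR (K * x).
pose y' (K x : R) := (f x * g x *+ 2 + K * f x ^+ 2) * expR (K * x).
have dy (K x : R) : 0 < x < 1 -> is_derive x 1 (y K) (y' K x).
  move=> x01; have dfx := df _ x01; rewrite /y.
  apply: is_derive_eq; rewrite /y' /GRing.scale /=; ring.
have fg (x : R) : 0 < x < 1 -> `|f x * g x *+ 2| <= C *+ 2 * f x ^+ 2.
  move=> x01; rewrite normrMn normrM mulrnAl lerMn2r/= -(@real_normK _ (f x))
    ?num_real//.
  by rewrite expr2 mulrCA ler_wpM2l// gf.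
have y0 K : y K t <= 0 -> f t = 0.
  rewrite /y pmulr_lle0 ?expR_gt0// => f0.
  by apply/eqP; rewrite -sqrf_eq0 eq_le f0 sqr_ge0.
have ym K : y K m = 0 by rewrite /y fm expr0n mul0r.
case/andP: (m01) => m0 m1; case/andP: (t01) => t0 t1.
have [mt|/ltW tm] := leP m t.
- have [x /andP[mx xt]] := MVT01 (dy (- (C *+ 2))) m0 mt t1.
  rewrite ym subr0 => yt; apply: (y0 (- (C *+ 2))); rewrite yt.
  have x01 : 0 < x < 1 by rewrite (lt_le_trans m0)// (le_lt_trans xt).
  rewrite mulr_le0_ge0 ?subr_ge0// /y' pmulr_lle0 ?expR_gt0//.
  by rewrite mulNr subr_le0 (le_trans _ (fg _ x01))// ler_norm.
- have [x /andP[tx xm]] := MVT01 (dy (C *+ 2)) t0 tm m1.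
  rewrite ym sub0r => yt; apply: (y0 (C *+ 2)); rewrite -oppr_ge0 yt.
  have x01 : 0 < x < 1 by rewrite (lt_le_trans t0)// (le_lt_trans xm).
  rewrite mulr_ge0 ?subr_ge0// /y' mulr_ge0 ?expR_ge0//.
  by rewrite addrC -lerBlDr sub0r (le_trans _ (fg _ x01))// -normrN ler_norm.
Qed.

Lemma primitive_norm_le h g (s t : R) : integrable01 h -> integrable01 g ->
  (forall x, 0 <= g x) -> ae01 (fun x => `|h x| <= g x) ->
  0 <= s -> s <= t -> t <= 1 ->
  `|primitive h t - primitive h s| <= primitive g t - primitive g s.
Proof.
move=> ih ig g0 hg s0 st t1; rewrite !primitiveB//.
have sub : `]s, t[ `<=` `]0, 1[ by apply: subset_itv; rewrite bnd_simp.
(* The bound on [h] is available only inside ]0, 1[, so the endpoints of [s, t] are discarded. *)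
have oo f : integrable01 f ->
    \int[mu]_(x in `[s, t]) f x = \int[mu]_(x in `]s, t[) f x.
  move=> If; rewrite /Rintegral integral_oo_cc//.
  apply: (measurable_funS _ sub) => //; apply/measurable_oo_cc.
  exact: integrable01_measurable.
have ooi f : integrable01 f -> mu.-integrable `]s, t[ (EFin \o f).
  by move=> If; apply: integrableS (proj2 (integrable_oo_cc _ _ _) If).
rewrite !oo// (le_trans (le_normr_Rintegral _ (ooi _ ih)))//.
have ihn := ooi _ (integrable01_norm ih); have igo := ooi _ ig.
apply: fine_le; [exact: integrable_fin_num..|].
have [/measurable_EFinP mh _] := integrableP _ _ _ ihn.
have [/measurable_EFinP mg _] := integrableP _ _ _ igo.
have F : Filter (almost_everywhere mu) by exact: ae_filter_ringOfSetsType.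
apply: ae_ge0_le_integral => //.
- exact/measurable_EFinP.
- by move=> x _; rewrite lee_fin.
- exact/measurable_EFinP.
by move: hg; apply: (@filterS _ _ F) => x + /sub x01 => /(_ x01);
  rewrite lee_fin.
Qed.

(** Write F for the function and F' for its derivative. By the mean value theorem F(t) = F'(x) (t -
    m) with |t - m| <= 1, and F'(x) is the integral of [h] from m to x because F'(m) = 0. Its size
    is at most the integral of [g] between m and x, hence between m and t. *)
Lemma affine_primitive2_le a b h g (m t : R) :
  integrable01 h -> integrable01 g ->
  (forall x, 0 <= g x) -> ae01 (fun x => `|h x| <= g x) ->
  0 < m < 1 -> affine_primitive2 a b h m = 0 -> b + primitive h m = 0 ->
  0 < t < 1 -> `|affine_primitive2 a b h t| <= `|primitive g t - primitive g m|.
Proof.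
move=> ih ig g0 hg /andP[m0 m1] Fm Dm /andP[t0 t1].
have dF (x : R) := @affine_primitive2_derive R a b h x ih.
have mono (s u : R) : 0 <= s -> s <= u -> u <= 1 ->
    primitive g s <= primitive g u.
  move=> s0 su u1; rewrite -subr_ge0;
    apply: le_trans (normr_ge0 (primitive h u - primitive h s)) _.
  exact: primitive_norm_le.
have b01 (x : R) : `|x| <= 1 -> forall y, `|y * x| <= `|y|.
  by move=> x1 y; rewrite normrM ler_piMr.
have Dx x : b + primitive h x = primitive h x - primitive h m by lra.
have [mt|/ltW tm] := leP m t.
- have [x /andP[mx xt] e] := MVT01 dF m0 mt t1.
  rewrite -[affine_primitive2 a b h t]subr0 -Fm e.
  apply: le_trans (b01 _ _ _) _; first by rewrite ger0_norm ?subr_ge0//; lra.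
  rewrite Dx (le_trans (primitive_norm_le ih ig g0 hg (ltW m0) mx
    (ltW (le_lt_trans xt t1))))//.
  by rewrite (le_trans _ (ler_norm _))// lerB// mono//; lra.
- have [x /andP[tx xm] e] := MVT01 dF t0 tm m1.
  rewrite -normrN -[- affine_primitive2 a b h t]add0r -Fm e.
  apply: le_trans (b01 _ _ _) _; first by rewrite ger0_norm ?subr_ge0//; lra.
  rewrite Dx distrC (le_trans (primitive_norm_le ih ig g0 hg
    (ltW (lt_le_trans t0 tx)) xm (ltW m1)))//.
  by rewrite distrC (le_trans _ (ler_norm _))// lerB// mono//; lra.
Qed.

(* With j the primitive of |F1| + |F2| vanishing at m, both |F1| and |F2| are
   at most K |j|, so that |j'| <= 2 K |j|. *)
Lemma affine_primitive2_unique a1 b1 h1 a2 b2 h2 (K m : R) :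
  let F1 := affine_primitive2 a1 b1 h1 in
  let F2 := affine_primitive2 a2 b2 h2 in
  integrable01 h1 -> integrable01 h2 -> 0 <= K ->
  ae01 (fun x => `|h1 x| <= K * (`|F1 x| + `|F2 x|)) ->
  ae01 (fun x => `|h2 x| <= K * (`|F1 x| + `|F2 x|)) ->
  0 < m < 1 -> F1 m = 0 -> b1 + primitive h1 m = 0 ->
  F2 m = 0 -> b2 + primitive h2 m = 0 ->
  forall t : R, 0 < t < 1 -> F1 t = 0 /\ F2 t = 0.
Proof.
move=> F1 F2 ih1 ih2 K0 hF1 hF2 m01 F1m D1m F2m D2m.
pose g x := K * (`|F1 x| + `|F2 x|).
have g0 x : 0 <= g x by rewrite mulr_ge0// addr_ge0.
have cg : continuous01 g.
  apply: continuous01M; first exact: continuous01_cst.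
  by apply: continuous01D; apply: continuous01_norm;
    exact: affine_primitive2_cont.
have ig := integrable01_cont cg.
have F1le := affine_primitive2_le ih1 ig g0 hF1 m01 F1m D1m.
have F2le := affine_primitive2_le ih2 ig g0 hF2 m01 F2m D2m.
pose j x := primitive g x - primitive g m.
have dj (x : R) : 0 < x < 1 -> is_derive x 1 j (g x).
  move=> x01; have dg := primitive_derive cg x01.
  by rewrite /j; apply: is_derive_eq; rewrite subr0.
have gj (x : R) : 0 < x < 1 -> `|g x| <= (K *+ 2) * `|j x|.
  move=> x01; rewrite ger0_norm// /g mulrnAl -mulrnAr ler_wpM2l// mulr2n.
  by apply: lerD; [exact: F1le|exact: F2le].
have jm : j m = 0 by rewrite /j subrr.
move=> t t01; have jt := gronwall0 dj gj m01 jm t01.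
have := F1le _ t01; have := F2le _ t01; rewrite -/(j t) jt normr0 !normr_le0.
by move=> /eqP ? /eqP ?.
Qed.

End gronwall.

(** * The inner product of L2(0, 1) *)

Section L2inner.
Context (R : realType).
Notation mu := (@lebesgue_measure R).
Local Notation re := complex.Re.
Local Notation im := complex.Im.
Implicit Types f g h : L2 R.

Lemma ae01W (P : R -> Prop) : (forall x, P x) -> ae01 P.
Proof. by move=> hP; apply: aeW => x _; exact: hP. Qed.

Lemma ae01S (P Q : R -> Prop) : (forall x, P x -> Q x) -> ae01 P -> ae01 Q.
Proof. by move=> PQ hP; apply: ae01S2 (hP) (hP) => x /PQ. Qed.

Lemma L2_re f : Lfun01 2%:E (fun x => re (f x)).
Proof. by have /andP[] := valP (repr f). Qed.

Lemma L2_im f : Lfun01 2%:E (fun x => im (f x)).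
Proof. by have /andP[] := valP (repr f). Qed.

(** An element of L2 is evaluated through the representative chosen by [repr], so even the pointwise
    formulas for linear combinations hold only almost everywhere. *)
Lemma L2fun_pi (F : sqfun R) : ae01 (fun x => L2fun (\pi_(L2 R) F)%qT x = F x).
Proof.
have : repr (\pi_(L2 R) F)%qT - F \in @ae_zero R.
  by rewrite Quotient.idealrBE; apply/eqP; exact: reprK.
move=> /asboolP; apply: ae01S => x e; apply/eqP; rewrite -subr_eq0; apply/eqP.
exact: e.
Qed.

Lemma L2fun_lin (a : R[i]) f g :
  ae01 (fun x => (a *: f + g : L2 R) x = a * f x + g x).
Proof.
have -> : a *: f + g = \pi_(L2 R)%qT (a *: repr f + repr g).
  by rewrite raddfD /= reprK.
exact: L2fun_pi.
Qed.

Lemma L2fun0 : ae01 (fun x => (0 : L2 R) x = 0).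
Proof.
have -> : (0 : L2 R) = \pi_(L2 R)%qT 0 by rewrite raddf0.
exact: L2fun_pi.
Qed.

Lemma sqfun_of_subproof (u v : R -> R) : Lfun01 2%:E u -> Lfun01 2%:E v ->
  (fun x => u x +i* v x) \in @sqint R.
Proof. by move=> hu hv; apply/andP. Qed.

Definition L2of (u v : R -> R)
    (hu : Lfun01 2%:E u) (hv : Lfun01 2%:E v) : L2 R :=
  (\pi_(L2 R) (SqFun (sqfun_of_subproof hu hv)))%qT.

Lemma L2ofE u v hu hv : ae01 (fun x => @L2of u v hu hv x = u x +i* v x).
Proof. exact: L2fun_pi. Qed.

(** Allows explicit representatives in inner products, and passes to the closed interval on which
    primitives are taken. *)
Lemma dotL2_ae f g (fr fi gr gi : R -> R) :
  Lfun01 2%:E fr -> Lfun01 2%:E fi -> Lfun01 2%:E gr -> Lfun01 2%:E gi ->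
  ae01 (fun x => f x = fr x +i* fi x) -> ae01 (fun x => g x = gr x +i* gi x) ->
  dotL2 f g = (\int[mu]_(x in `[0, 1]) (fr x * gr x + fi x * gi x)) +i*
              (\int[mu]_(x in `[0, 1]) (fr x * gi x - fi x * gr x)).
Proof.
move=> hfr hfi hgr hgi fE gE.
have m01 u : integrable01 u -> measurable_fun (`]0, 1[%classic : set R) u.
  by move=> /integrable01_measurable; exact: (measurable_oo_cc 0 1 u).2.
have iM := @Lfun01_2M_integrable R.
have irr : integrable01 (fun x => fr x * gr x + fi x * gi x)
    by apply: integrable01D; exact: iM.
have iii : integrable01 (fun x => fr x * gi x - fi x * gr x)
    by apply: integrable01B; exact: iM.
have [hf hf'] := (L2_re f, L2_im f); have [hg hg'] := (L2_re g, L2_im g).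
have E1 : (fun x => re (conjc (f x) * g x)) =
    (fun x => re (f x) * re (g x) + im (f x) * im (g x)).
  by apply/funext => x; case: (f x) (g x) => a b [c d] /=; rewrite mulNr opprK.
have E2 : (fun x => im (conjc (f x) * g x)) =
    (fun x => re (f x) * im (g x) - im (f x) * re (g x)).
  by apply/funext => x; case: (f x) (g x) => a b [c d] /=; rewrite mulNr.
rewrite /dotL2 /cintegral E1 E2 -!Rintegral_oo_cc//; congr (_ +i* _).
- apply: eq_ae01_integral; [|exact: m01|].
    by apply: m01; apply: integrable01D; exact: iM.
  by apply: ae01S2 fE gE => x -> ->.
- apply: eq_ae01_integral; [|exact: m01|].
    by apply: m01; apply: integrable01B; exact: iM.
  by apply: ae01S2 fE gE => x -> ->.
Qed.

Lemma dotL2E f g :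
  dotL2 f g =
    (\int[mu]_(x in `[0, 1]) (re (f x) * re (g x) + im (f x) * im (g x))) +i*
    (\int[mu]_(x in `[0, 1]) (re (f x) * im (g x) - im (f x) * re (g x))).
Proof.
by apply: dotL2_ae; rewrite ?L2_re ?L2_im//; apply: ae01W => x;
  case: (L2fun _ _).
Qed.

Lemma dotL2_conj f g : dotL2 g f = conjc (dotL2 f g).
Proof.
rewrite !dotL2E /=; congr (_ +i* _).
  by apply: eq_Rintegral => x _; congr (_ + _); exact: mulrC.
rewrite -mulN1r -RintegralZl//.
  by apply: eq_Rintegral => x _; ring.
by apply: integrable01B; apply: Lfun01_2M_integrable; rewrite ?L2_re ?L2_im.
Qed.

Lemma dotL2_linr (a : R[i]) f g h :
  dotL2 f (a *: g + h) = a * dotL2 f g + dotL2 f h.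
Proof.
have iM := @Lfun01_2M_integrable R.
have [hf hf'] := (L2_re f, L2_im f); have [hg hg'] := (L2_re g, L2_im g).
have [hh hh'] := (L2_re h, L2_im h).
have hrg :
    Lfun01 2%:E (fun x => re a * re (g x) + (- im a) * im (g x) + re (h x)).
  exact: Lfun01_2_lin.
have hig : Lfun01 2%:E (fun x => re a * im (g x) + im a * re (g x) + im (h x)).
  exact: Lfun01_2_lin.
rewrite (dotL2_ae hf hf' hrg hig); last 2 first.
- by apply: ae01W => x; case: (L2fun _ _).
- apply: ae01S (L2fun_lin a g h) => x ->.
  case: a {hrg hig} => ar ai; case: (g x) (h x) => gr gi [hr hi].
  by congr (_ +i* _) => //=; ring.
pose p x := re (f x) * re (g x) + im (f x) * im (g x).
pose q x := re (f x) * im (g x) - im (f x) * re (g x).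
pose p' x := re (f x) * re (h x) + im (f x) * im (h x).
pose q' x := re (f x) * im (h x) - im (f x) * re (h x).
have ip : integrable01 p by apply: integrable01D; exact: iM.
have iq : integrable01 q by apply: integrable01B; exact: iM.
have ip' : integrable01 p' by apply: integrable01D; exact: iM.
have iq' : integrable01 q' by apply: integrable01B; exact: iM.
have lin (b c : R) u v w : integrable01 u -> integrable01 v -> integrable01 w ->
    \int[mu]_(x in `[0, 1]) (b * u x + c * v x + w x) =
    b * primitive u 1 + c * primitive v 1 + primitive w 1.
  move=> iu iv iw; rewrite RintegralD//; last first.
    by apply: (integrable01D (integrable01Z _ iu) (integrable01Z _ iv)).
  rewrite RintegralD//; [|exact: integrable01Z..].
  by rewrite !RintegralZl.
rewrite [RHS](_ : _ = (re a * primitive p 1 + (- im a) * primitive q 1 +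
  primitive p' 1) +i*
   (re a * primitive q 1 + im a * primitive p 1 + primitive q' 1)); last first.
  rewrite !dotL2E -/(primitive p 1) -/(primitive q 1) -/(primitive p' 1)
    -/(primitive q' 1).
  by case: a {hrg hig} => ar ai /=; congr (_ +i* _) => //=; ring.
rewrite -!lin//; congr (_ +i* _); apply: eq_Rintegral => x _;
  rewrite /p /q /p' /q'; ring.
Qed.

Lemma dotL2_eq0 f : dotL2 f f = 0 -> f = 0.
Proof.
rewrite dotL2E => -[e _]; apply/L2_eqP.
have iff : integrable01 (fun x => re (f x) * re (f x) + im (f x) * im (f x)).
  by apply: integrable01D; apply: Lfun01_2M_integrable; rewrite ?L2_re ?L2_im.
have := integrable01_ae0 iff _ e => /(_
    (fun x => addr_ge0 (sqr_ge0 _) (sqr_ge0 _))) f0.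
apply: ae01S2 f0 L2fun0 => x + ->; case: (f x) => a b /= /eqP.
by rewrite paddr_eq0 ?sqr_ge0// !mulf_eq0 !orbb => /andP[/eqP -> /eqP ->].
Qed.

End L2inner.

(** * Dissipative operators *)

Section dissipative.
Context (R : realType).
Local Notation re := complex.Re.
Local Notation im := complex.Im.
Implicit Types (f g x y : L2 R) (T : set (L2 R * L2 R)).

Lemma dotL2_linl (a : R[i]) f g x :
  dotL2 (a *: g + x) f = conjc a * dotL2 g f + dotL2 x f.
Proof.
rewrite dotL2_conj dotL2_linr [dotL2 g f]dotL2_conj [dotL2 x f]dotL2_conj.
by rewrite rmorphD rmorphM.
Qed.

Lemma dotL2_0r f : dotL2 f 0 = 0.
Proof.
by apply/(addrI (dotL2 f 0)); rewrite addr0 -{1}[dotL2 f 0]mul1r -dotL2_linr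
  scaler0 addr0.
Qed.

Lemma dotL2Zr (a : R[i]) f g : dotL2 f (a *: g) = a * dotL2 f g.
Proof. by rewrite -[a *: g]addr0 dotL2_linr dotL2_0r addr0. Qed.

Lemma dotL2Br f g x : dotL2 f (g - x) = dotL2 f g - dotL2 f x.
Proof. by rewrite addrC -scaleN1r dotL2_linr mulN1r addrC. Qed.

Lemma affine_ge0 (a c : R) : (forall s, 0 <= s * a + c) -> a = 0.
Proof.
move=> h; apply/eqP/negPn/negP => a0.
(* At this point the affine function equals -1. *)
by have := h (- (c + 1) / a); rewrite divfK//; lra.
Qed.

(* The form Im <x, T y> is positive semidefinite on the domain of T, so its
   isotropic vectors lie in its kernel. *)
Lemma dissipative_adjoint T f g : dissipative T -> T (f, g) ->
  im (dotL2 f g) = 0 -> adjoint T (f, g).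
Proof.
move=> [[[T0 Tlin] _] _ Tpos] Tfg fg0 x y Txy /=.
(* Positivity at t f + x: the term in |t|^2 carries the factor Im <f, g> = 0, so what remains is
   affine in t. *)
have pos (t : R[i]) :
    0 <= im (conjc t * dotL2 f y + t * dotL2 x g) + im (dotL2 x y).
  have := Tpos (t *: f + x) (t *: g + y) (Tlin t _ _ Tfg Txy).
  rewrite dotL2_linr !dotL2_linl.
  move: (dotL2 f g) (dotL2 f y) (dotL2 x g) (dotL2 x y) fg0 =>
    [a b] [c d] [e i] [j k] /= ->.
  case: t => tr ti /=; lra.
have -> : dotL2 g x = conjc (dotL2 x g) by exact: dotL2_conj.
move: (dotL2 f y) (dotL2 x g) (dotL2 x y) pos => [a b] [c d] [e i] pos /=.
(* Real t compares the imaginary parts of <f, y> and <x, g>, purely imaginary t their real parts. *)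
have bd : b + d = 0.
  apply: (@affine_ge0 _ i) => s; have := pos (s +i* 0); rewrite /=; lra.
have ac : c - a = 0.
  apply: (@affine_ge0 _ i) => s; have := pos (0 +i* s); rewrite /=; lra.
by congr (_ +i* _); lra.
Qed.

Lemma dissipative_real_eigen T f (l : R) : dissipative T -> T (f, l%:C *: f) ->
  adjoint T (f, l%:C *: f).
Proof.
move=> dT Tf; apply: dissipative_adjoint => //.
rewrite dotL2Zr dotL2E /= mul0r addr0.
rewrite [X in l * X](_ : _ = 0) ?mulr0//.
rewrite /Rintegral integral0_eq// => x _; congr _%:E; ring.
Qed.

(** There are no Jordan chains at a real eigenvalue: if T f = l f + h and T h = l h, then h is also
    an eigenvector of the adjoint, so <h, h> = <h, T f> - l <h, f> = 0. *)
Lemma dissipative_root_space T (l : R) : dissipative T ->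
  root_space T l%:C = [set f | T (f, l%:C *: f)].
Proof.
move=> dT; have [[[T0 Tlin] _] _ _] := dT.
apply/seteqP; split=> [f [k _]|f Tf] /=; last first.
  by exists 1%N => //=; exists (l%:C *: f) => //; rewrite subrr.
elim: k f => [f ->|k IH f [g Tfg /IH Th]]; first by rewrite scaler0.
set h := g - l%:C *: f in Th *.
have := dissipative_real_eigen dT Th Tfg => /= e.
have h0 : h = 0.
  apply: dotL2_eq0; rewrite {2}/h dotL2Br e dotL2Zr.
  rewrite -[_ *: h]addr0 dotL2_linl [dotL2 0 f]dotL2_conj dotL2_0r rmorph0
    addr0.
  by rewrite /conjc /= oppr0 subrr.
by have /eqP := h0; rewrite subr_eq0 => /eqP <-.
Qed.

End dissipative.

(** * The differential equation of the adjoint *)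

Section operator.
Context (R : realType).
Notation mu := (@lebesgue_measure R).
Local Notation re := complex.Re.
Local Notation im := complex.Im.
Implicit Types (f g : L2 R) (h k u v : R -> R) (T : set (L2 R * L2 R)).

Lemma Linfty_bounded (V : R -> R) : Lfun01 +oo%E V ->
  measurable_fun (`[0, 1]%classic : set R) V /\
  exists M : R, ae01 (fun x => `|V x| <= M).
Proof.
rewrite /Lfun01 inE => /andP[/[!inE]/= mV].
rewrite /finite_norm unlock /Lnorm.
(* Positivity of the total measure selects the essential supremum in the definition of the norm. *)
have mT : (0 < mu setT)%E.
  apply: (@lt_le_trans _ _ (mu `[0, 1])).
    by rewrite lebesgue_measure_itv/= lte_fin ltr01 sube0 lte_fin.
  by apply: le_measure => //; rewrite inE /=.
rewrite mT => supV; have [M VM] := @ess_supr_bounded _ _ R mu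
  (Num.norm \o (V \_ `]0, 1[)) supV.
split.
  by apply/measurable_oo_cc; apply/(measurable_restrictT _ _).2.
exists M; have F : Filter (almost_everywhere mu)
  by exact: ae_filter_ringOfSetsType.
by move: VM; apply: (@filterS _ _ F) => x + x01; rewrite /= patchE mem_set.
Qed.

Lemma eq_ae01_primitive h k (x : R) : integrable01 h -> integrable01 k ->
  ae01 (fun x => h x = k x) -> 0 <= x <= 1 -> primitive h x = primitive k x.
Proof.
move=> ih ik hk /andP[x0 x1].
have i0 : integrable01 (fun=> 0 : R)
  by exact/integrable01_cont/continuous01_cst.
have hk0 : ae01 (fun x => `|h x - k x| <= 0).
  by apply: ae01S hk => t ->; rewrite subrr normr0.
have := primitive_norm_le (integrable01B ih ik) i0 (fun=> lexx 0) hk0 (lexx 0)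
    x0 x1.
rewrite !primitive0 !subr0 [X in _ <= X -> _]/primitive Rintegral_cst//= mul0r
  normr_le0.
rewrite /primitive RintegralB//; try exact: integrable01S.
by rewrite subr_eq0 => /eqP.
Qed.

(** The source of all test functions: double primitives satisfy the boundary conditions at 0
    automatically, and the two hypotheses are those at 1. *)
Lemma minimal_laplacian_primitive k (k2 : Lfun01 2%:E k)
    (u2 : Lfun01 2%:E (primitive (primitive k))) :
  primitive k 1 = 0 -> primitive (primitive k) 1 = 0 ->
  minimal_laplacian R (L2of u2 (Lfun01_2_0 R), - L2of k2 (Lfun01_2_0 R)).
Proof.
move=> Pk PPk; set K := L2of k2 _.
have ik := Lfun01_2_integrable k2.
have iK : integrable01 (fun x => re (K x)) by exact/Lfun01_2_integrable/L2_re.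
have iK' : integrable01 (fun x => im (K x)) by exact/Lfun01_2_integrable/L2_im.
have i0 : integrable01 (fun=> 0 : R)
  by exact/integrable01_cont/continuous01_cst.
have Kk : ae01 (fun x => re (K x) = k x).
  by apply: ae01S (L2ofE k2 (Lfun01_2_0 R)) => x ->.
have K0 : ae01 (fun x => im (K x) = 0).
  by apply: ae01S (L2ofE k2 (Lfun01_2_0 R)) => x ->.
have P0 (x : R) : primitive (fun=> 0) x = 0 :> R.
  by rewrite /primitive Rintegral_cst//= mul0r.
exists (fun x => (primitive (primitive k) x)%:C), (fun x => (primitive k x)%:C).
rewrite /= opprK; split; last by rewrite !primitive0 Pk PPk.
split.
- exact: L2ofE.
- split; [exact/integrable01_cont/primitive_cont|exact: i0|].
  move=> x x01; rewrite primitive0 add0r.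
  by congr (_ +i* _); rewrite -[RHS]/(primitive (fun=> 0) x) P0.
- split => //; move=> x x01; rewrite primitive0 add0r.
  rewrite /cintegral -/(primitive (fun t => re (K t)) x)
    -/(primitive (fun t => im (K t)) x).
  by rewrite (eq_ae01_primitive iK ik)// (eq_ae01_primitive iK' i0)// P0.
Qed.

(** The real and imaginary parts of the adjoint relation, tested against real functions. They say
    weakly that (Re f)'' = V Im f - Re g and (Im f)'' = - V Re f - Im g. *)
Lemma adjoint_weak (V : R -> R) T f g : Lfun01 +oo%E V ->
  op_add (minimal_laplacian R) (op_scale 'i (multiplication V)) `<=` T ->
  adjoint T (f, g) ->
  forall k, Lfun01 2%:E k -> primitive k 1 = 0 ->
    primitive (primitive k) 1 = 0 ->
  \int[mu]_(x in `[0, 1]) (re (f x) * k x) =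
    \int[mu]_(x in `[0, 1])
      ((V x * im (f x) - re (g x)) * primitive (primitive k) x) /\
  \int[mu]_(x in `[0, 1]) (im (f x) * k x) =
    \int[mu]_(x in `[0, 1])
      ((- (V x * re (f x)) - im (g x)) * primitive (primitive k) x).
Proof.
move=> /Linfty_bounded[mV [M VM]] AT adj k k2 Pk PPk.
have ik := Lfun01_2_integrable k2.
have u2 : Lfun01 2%:E (primitive (primitive k)).
  exact/Lfun01_2_cont/primitive_cont/integrable01_cont/primitive_cont.
set u := primitive (primitive k) in u2 *.
have Vu2 := Lfun01_2_bounded mV VM u2.
pose z2 := Lfun01_2_0 R.
have nk2 : Lfun01 2%:E (fun x => (-1) * k x) by exact: Lfun01_2Z.
set y := L2of u2 z2; set Ky := L2of k2 z2; set Vy := L2of Vu2 z2.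
(* With y the double primitive of k, A y = - k + i V y. *)
have Ty : T (y, - Ky + 'i *: Vy).
  apply: AT; exists (- Ky), ('i *: Vy); split => //=.
    exact: minimal_laplacian_primitive.
  exists Vy => //=; apply: ae01S2 (L2ofE Vu2 z2) (L2ofE u2 z2) => x -> ->.
  by congr (_ +i* _); rewrite /= ?mulr0 ?mul0r ?subr0 ?addr0.
have yE : ae01 (fun x =>
    (- Ky + 'i *: Vy : L2 R) x = ((-1) * k x) +i* (V x * u x)).
  have E := L2fun_lin 'i Vy (- Ky); rewrite addrC.
  have E' := L2fun_lin (-1) Ky 0; rewrite scaleN1r addr0 in E'.
  apply: ae01S2 (ae01S2 (fun x => @conj _ _) E E')
    (ae01S2 (fun x => @conj _ _) (L2ofE Vu2 z2)
    (ae01S2 (fun x => @conj _ _) (L2ofE k2 z2) (L2fun0 R))) =>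
      x [-> ->] [-> [-> ->]].
  by congr (_ +i* _) => /=; ring.
have fE : ae01 (fun x => f x = re (f x) +i* im (f x)) by apply: ae01W => x;
    case: (f x).
have gE : ae01 (fun x => g x = re (g x) +i* im (g x)) by apply: ae01W => x;
    case: (g x).
have := adj _ _ Ty; rewrite /=.
rewrite (dotL2_ae (L2_re f) (L2_im f) nk2 Vu2 fE yE).
rewrite (dotL2_ae (L2_re g) (L2_im g) u2 z2 gE (L2ofE u2 z2)) => -[].
have iM := @Lfun01_2M_integrable R.
have Vfr2 := Lfun01_2_bounded mV VM (L2_re f).
have Vfi2 := Lfun01_2_bounded mV VM (L2_im f).
have B (a b : R) h1 h2 : integrable01 h1 -> integrable01 h2 ->
    \int[mu]_(x in `[0, 1]) (a * h1 x + b * h2 x) =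
    a * primitive h1 1 + b * primitive h2 1.
  by move=> i1 i2; rewrite RintegralD ?RintegralZl//; exact: integrable01Z.
have [ifrk ifik] := (iM _ _ (L2_re f) k2, iM _ _ (L2_im f) k2).
have [iVfru iVfiu] := (iM _ _ Vfr2 u2, iM _ _ Vfi2 u2).
have [igru igiu] := (iM _ _ (L2_re g) u2, iM _ _ (L2_im g) u2).
have E1 :
    \int[mu]_(x in `[0, 1]) (re (f x) * (-1 * k x) + im (f x) * (V x * u x)) =
    (-1) * primitive (fun x => re (f x) * k x) 1 +
    1 * primitive (fun x => V x * im (f x) * u x) 1.
  by rewrite -B//; apply: eq_Rintegral => x _; ring.
have E2 :
    \int[mu]_(x in `[0, 1]) (re (f x) * (V x * u x) - im (f x) * (-1 * k x)) =
    1 * primitive (fun x => im (f x) * k x) 1 +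
    1 * primitive (fun x => V x * re (f x) * u x) 1.
  by rewrite -B//; apply: eq_Rintegral => x _; ring.
have E3 : \int[mu]_(x in `[0, 1]) (re (g x) * u x + im (g x) * 0) =
    primitive (fun x => re (g x) * u x) 1.
  by apply: eq_Rintegral => x _; ring.
have E4 : \int[mu]_(x in `[0, 1]) (re (g x) * 0 - im (g x) * u x) =
    (-1) * primitive (fun x => im (g x) * u x) 1.
  by rewrite -RintegralZl//; apply: eq_Rintegral => x _; ring.
rewrite E1 E2 E3 E4 => e1 e2; split.
- transitivity (1 * primitive (fun x => V x * im (f x) * u x) 1 +
     (-1) * primitive (fun x => re (g x) * u x) 1).
    by rewrite -e1 /primitive; ring.
  by rewrite -B//; apply: eq_Rintegral => x _; ring.
- transitivity ((-1) * primitive (fun x => V x * re (f x) * u x) 1 +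
     (-1) * primitive (fun x => im (g x) * u x) 1).
    by rewrite -e2 /primitive; ring.
  by rewrite -B//; apply: eq_Rintegral => x _; ring.
Qed.

End operator.

(** * Regularity and unique continuation for the adjoint equation *)

Section continuation.
Context (R : realType).
Notation mu := (@lebesgue_measure R).
Local Notation re := complex.Re.
Local Notation im := complex.Im.
Implicit Types (f g : L2 R) (T : set (L2 R * L2 R)).

Definition vanishes_on (c d : R) : set (L2 R) :=
  [set f | ae01 (fun x => c < x < d -> f x = 0)].

Lemma vanishes_on_subspace c d : is_subspace (vanishes_on c d).
Proof.
split; first by apply: ae01S (@L2fun0 R) => x ->.
move=> a f g f0 g0; rewrite /vanishes_on /=.
apply: ae01S2 (L2fun_lin a f g) (ae01S2 (fun x => @conj _ _) f0 g0).
move=> x -> [fx gx] xcd.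
by rewrite fx// gx// mulr0 addr0.
Qed.

Section extension.
Context (V : R -> R) (T : set (L2 R * L2 R)).
Context (V_Linfty : Lfun01 +oo%E V).
Context (T_ext : op_add (minimal_laplacian R) (op_scale 'i (multiplication V))
  `<=` T).

(* A weak solution of - f'' - i V f = g, split into real and imaginary parts. *)
Lemma adjoint_ode f g : adjoint T (f, g) ->
  let h1 x := V x * im (f x) - re (g x) in
  let h2 x := - (V x * re (f x)) - im (g x) in
  exists a1 b1 a2 b2 : R, [/\ integrable01 h1, integrable01 h2,
    ae01 (fun x => re (f x) = affine_primitive2 a1 b1 h1 x) &
    ae01 (fun x => im (f x) = affine_primitive2 a2 b2 h2 x)].
Proof.
move=> adj h1 h2; have [mV [M VM]] := Linfty_bounded V_Linfty.
have ih1 : integrable01 h1.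
  by apply: integrable01B; apply: Lfun01_2_integrable; rewrite ?L2_re//;
    exact: Lfun01_2_bounded VM (L2_im f).
have ih2 : integrable01 h2.
  apply: integrable01B; apply: Lfun01_2_integrable; rewrite ?L2_im//.
  have := Lfun01_2Z (-1) (Lfun01_2_bounded mV VM (L2_re f)); congr is_true;
      congr Lfun01.
  by apply/funext => x; rewrite mulN1r.
have W := adjoint_weak V_Linfty T_ext adj.
have [a1 [b1 E1]] := weak_second_derivative (L2_re f) ih1
    (fun k k2 P1 P2 => proj1 (W k k2 P1 P2)).
have [a2 [b2 E2]] := weak_second_derivative (L2_im f) ih2
    (fun k k2 P1 P2 => proj2 (W k k2 P1 P2)).
exists a1, b1, a2, b2.
by split; [exact: ih1|exact: ih2|exact: E1|exact: E2].
Qed.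

Lemma complex_eq0 (z : R[i]) : re z = 0 -> im z = 0 -> z = 0.
Proof. by case: z => a b /= -> ->. Qed.

(** Where f vanishes on an interval, so do the second derivatives of its real and imaginary parts;
    with f = 0 the equations reduce these to - Re g and - Im g. *)
Lemma adjoint_vanishes_on f g (c d : R) :
  0 <= c -> d <= 1 -> adjoint T (f, g) ->
  vanishes_on c d f -> vanishes_on c d g.
Proof.
move=> c0 d1 /adjoint_ode[a1 [b1 [a2 [b2 [ih1 ih2 E1 E2]]]]] f0.
have [|_ h10] := @affine_primitive2_eq0 _ a1 b1 _ c d ih1 c0 d1.
  by apply: ae01S2 E1 f0 => x <- fx0 /fx0 ->.
have [|_ h20] := @affine_primitive2_eq0 _ a2 b2 _ c d ih2 c0 d1.
  by apply: ae01S2 E2 f0 => x <- fx0 /fx0 ->.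
apply: ae01S2 f0 (ae01S2 (fun x => @conj _ _) h10 h20) => x fx0 [h1x h2x] xcd.
have := h1x xcd; have := h2x xcd; rewrite fx0//= !mulr0 oppr0 !sub0r.
by move=> /eqP; rewrite oppr_eq0 => /eqP i0 /eqP; rewrite oppr_eq0 => /eqP r0;
  exact: complex_eq0.
Qed.

(** The real and imaginary parts of f have zero Cauchy data at the midpoint m, and with g = l f
    their second derivatives are linear in them with bounded coefficients. *)
Lemma eigen_unique_continuation f (l c d : R) : 0 <= c -> c < d -> d <= 1 ->
  adjoint T (f, l%:C *: f) -> vanishes_on c d f -> f = 0.
Proof.
move=> c0 cd d1 adj f0; have [_ [M VM]] := Linfty_bounded V_Linfty.
pose m := (c + d) / 2.
have mcd : c < m < d by apply/andP; rewrite /m; split; lra.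
have m01 : 0 < m < 1 by apply/andP; rewrite /m; split; lra.
(* The second derivatives V Im f - l Re f and - V Re f - l Im f have coefficients bounded by |M| and
   |l|. *)
pose K : R := `|M| + `|l|.
have K0 : 0 <= K by rewrite addr_ge0.
have bnd (v r i F1 F2 : R) : r = F1 -> i = F2 -> `|v| <= M ->
    `|v * i - l * r| <= K * (`|F1| + `|F2|) /\
    `|- (v * r) - l * i| <= K * (`|F1| + `|F2|).
  move=> -> -> vM; have vM' : `|v| <= `|M| by rewrite (le_trans vM)// ler_norm.
  have vK : `|v| <= K by rewrite (le_trans vM')// lerDl.
  have lK : `|l| <= K by rewrite lerDr.
  split; rewrite (le_trans (ler_normB _ _))// ?normrN !normrM mulrDr.
    by rewrite addrC lerD// ler_wpM2r.
  by rewrite lerD// ler_wpM2r.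
have [a1 [b1 [a2 [b2 [ih1 ih2 E1 E2]]]]] := adjoint_ode adj.
have [|/(_ m mcd)[F1m D1m] _] := @affine_primitive2_eq0 _ a1 b1 _ c d ih1 c0 d1.
  by apply: ae01S2 E1 f0 => x <- fx0 /fx0 ->.
have [|/(_ m mcd)[F2m D2m] _] := @affine_primitive2_eq0 _ a2 b2 _ c d ih2 c0 d1.
  by apply: ae01S2 E2 f0 => x <- fx0 /fx0 ->.
have lf := ae01S2 (fun x => @conj _ _) (L2fun_lin l%:C f 0) (@L2fun0 R).
rewrite addr0 in lf.
have H := ae01S2 (fun x => @conj _ _) (ae01S2 (fun x => @conj _ _) E1 E2)
   (ae01S2 (fun x => @conj _ _) lf VM).
apply/L2_eqP.
pose h1 x := V x * im (f x) - re ((l%:C *: f : L2 R) x).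
pose h2 x := - (V x * re (f x)) - im ((l%:C *: f : L2 R) x).
have F0 : forall t : R, 0 < t < 1 ->
    affine_primitive2 a1 b1 h1 t = 0 /\ affine_primitive2 a2 b2 h2 t = 0.
  apply: (affine_primitive2_unique ih1 ih2 K0 _ _ m01 F1m D1m F2m D2m);
    apply: ae01S H => x [[e1 e2] [[-> ->] vM]].
    have [+ _] := bnd _ _ _ _ _ e1 e2 vM; congr is_true; congr (`|_| <= _).
    by case: (f x) => p q /=; ring.
  have [_ +] := bnd _ _ _ _ _ e1 e2 vM; congr is_true; congr (`|_| <= _).
  by case: (f x) => p q /=; ring.
have : ae01 (fun x : R => 0 < x < 1) by apply: aeW => x; rewrite /= in_itv/=.
move=> H01; apply: ae01S2 H (ae01S2 (fun x => @conj _ _) H01 (@L2fun0 R)).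
move=> x [[e1 e2] _] [x01 ->]; have [z1 z2] := F0 x x01.
by apply: complex_eq0; rewrite ?e1 ?e2.
Qed.

End extension.
End continuation.

(** * Counting eigenvalues *)

Section subspaces.
Context (K : fieldType) (H : lmodType K).
Implicit Types (Z : set H).

Lemma subspace_scale Z (a : K) f : is_subspace Z -> Z f -> Z (a *: f).
Proof. by move=> [Z0 Zlin] Zf; rewrite -[_ *: _]addr0; exact: Zlin. Qed.

Lemma subspace_add Z f g : is_subspace Z -> Z f -> Z g -> Z (f + g).
Proof. by move=> [Z0 Zlin] Zf Zg; rewrite -[f]scale1r; exact: Zlin. Qed.

Lemma subspace_sum Z I (r : seq I) (P : pred I) (F : I -> H) : is_subspace Z ->
  (forall i, P i -> Z (F i)) -> Z (\sum_(i <- r | P i) F i).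
Proof.
move=> sZ ZF; apply: (big_ind Z) => //; first by case: sZ.
by move=> f g; exact: subspace_add.
Qed.

End subspaces.

(** * Sums of eigenvectors modulo an invariant subspace *)

Section eigenfamilies.
Context (R : realType) (H : lmodType R[i]).

Definition linearly_independent n (v : 'I_n -> H) :=
  forall c : 'I_n -> R[i], \sum_(i < n) c i *: v i = 0 -> forall i, c i = 0.

(** In the application [S] is the common part of the graphs of the operator and its adjoint, and [Z]
    consists of the functions vanishing on an interval. *)
Context (S : set (H * H)) (Z : set H) (S_sub : is_subspace S)
  (Z_sub : is_subspace Z).
Context (S_Z : forall f g, S (f, g) -> Z f -> Z g).
Context (eigen_Z : forall f (l : R), S (f, l%:C *: f) -> Z f -> f = 0).

Lemma eigen_scale (a : R[i]) f (l : R) : S (f, l%:C *: f) ->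
    S (a *: f, l%:C *: (a *: f)).
Proof.
rewrite scalerA mulrC -scalerA.
exact: (@subspace_scale _ _ S a (f, l%:C *: f) S_sub).
Qed.

(* The set of vectors of Z in the span of the eigenvectors is invariant, hence
   spanned by eigenvectors lying in Z. *)
Lemma eigen_sum_eq0 (ls : seq R) (F : R -> H) : uniq ls ->
  (forall l, l \in ls -> S (F l, l%:C *: F l)) -> Z (\sum_(l <- ls) F l) ->
  forall l, l \in ls -> F l = 0.
Proof.
elim: ls F => // l0 ls IH F /= /andP[l0ls uls] SF Zs.
have SF' l : l \in ls -> S (F l, l%:C *: F l) by move=> lls; apply: SF;
    rewrite inE lls orbT.
pose f := \sum_(l <- l0 :: ls) F l; pose g := \sum_(l <- l0 :: ls) l%:C *: F l.
have Sfg : S (f, g).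
  rewrite (_ : (f, g) = \sum_(l <- l0 :: ls) (F l, l%:C *: F l)); last first.
    rewrite /f /g; elim: (l0 :: ls) => [|l s IHs]; first by rewrite !big_nil.
    by rewrite !big_cons -IHs.
  by rewrite big_seq_cond; apply: subspace_sum => // l; rewrite andbT => /SF.
(* Applying the operator minus l0 removes the l0 term and multiplies each other [F l] by the nonzero
   number l - l0, so the induction hypothesis applies to the remaining sum. *)
have Zg : Z (g - l0%:C *: f).
  rewrite -scaleNr addrC; case: Z_sub => _; apply => //; exact: S_Z Sfg Zs.
have Fls l : l \in ls -> F l = 0.
  move=> lls; have := IH (fun l => (l - l0)%:C *: F l) uls.
  move=> /(_ (fun l lls => eigen_scale _ (SF' l lls)))/(_ _ l lls)/eqP.
  rewrite scaler_eq0 => /(_ _)/orP[|/eqP|/eqP//].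
  - move: Zg; congr Z; rewrite /f /g !big_cons scalerDr opprD addrACA subrr
    add0r.
    rewrite scaler_sumr -sumrB; apply: eq_bigr => k _.
    by rewrite -scalerBl -rmorphB.
  - by case=> /eqP; rewrite subr_eq0 => /eqP e; rewrite -e lls in l0ls.
move=> l; rewrite inE => /orP[/eqP ->|/Fls//].
apply: (eigen_Z (SF l0 (mem_head _ _))); move: Zs;
  rewrite big_cons big_seq big1 ?addr0//.
Qed.

Lemma eigen_lincomb n (lam : 'I_n -> R) (v : 'I_n -> H) (c : 'I_n -> R[i])
    (l : R) :
  (forall i, S (v i, (lam i)%:C *: v i)) ->
  S (\sum_(i < n | lam i == l) c i *: v i,
     l%:C *: \sum_(i < n | lam i == l) c i *: v i).
Proof.
move=> Sv.
rewrite (_ : (_, _) = \sum_(i < n | lam i == l)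
  (c i *: v i, l%:C *: (c i *: v i))).
  by apply: subspace_sum => // i /eqP <-; exact: eigen_scale.
elim: (index_enum _) => [|i s IHs]; first by rewrite !big_nil scaler0.
by rewrite !big_cons; case: ifP => // _; rewrite -IHs scalerDr.
Qed.

Lemma sum_fibers n (lam : 'I_n -> R) (x : 'I_n -> H) :
  \sum_(i < n) x i =
  \sum_(l <- undup (codom lam)) \sum_(i < n | lam i == l) x i.
Proof.
rewrite (exchange_big_dep predT)//=; apply: eq_bigr => i _.
rewrite -big_filter (eq_filter (a2 := pred1 (lam i))); last by move=> k;
  exact: eq_sym.
by rewrite filter_pred1_uniq ?undup_uniq ?mem_undup ?codom_f// big_seq1.
Qed.

(** Eigenvalues may repeat in [lam], so the terms are grouped by eigenvalue to reach the case of
    distinct ones. *)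
Lemma eigen_family_eq0 n (lam : 'I_n -> R) (v : 'I_n -> H) (c : 'I_n -> R[i]) :
  (forall i, S (v i, (lam i)%:C *: v i)) -> Z (\sum_(i < n) c i *: v i) ->
  forall l, \sum_(i < n | lam i == l) c i *: v i = 0.
Proof.
move=> Sv Zs l; have [lls|lls] := boolP (l \in codom lam); last first.
  rewrite big_pred0// => i; apply/negP => /eqP e.
  by rewrite -e codom_f in lls.
apply: (@eigen_sum_eq0 (undup (codom lam))
  (fun l => \sum_(i < n | lam i == l) c i *: v i));
  rewrite ?undup_uniq ?mem_undup -?sum_fibers//.
by move=> k _; exact: eigen_lincomb.
Qed.

End eigenfamilies.

(** * From independent families of eigenvectors to multiplicities *)

Section spectrum.
Context (R : realType).
Implicit Types (T : set (L2 R * L2 R)) (f g : L2 R).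

(** If n > p, the n by p matrix of W-coordinates kills a nonzero row vector; the corresponding
    combination of the [v i] loses its W part and lies in [Z], against independence modulo [Z]. *)
Lemma independent_family_le (H : lmodType R[i]) (Z W : set H) n p
    (v : 'I_n -> H) :
  is_subspace Z -> has_dim W p ->
  (forall i, exists u w, [/\ v i = u + w, Z u & W w]) ->
  (forall c, Z (\sum_(i < n) c i *: v i) -> forall i, c i = 0) ->
  (n <= p)%N.
Proof.
move=> sZ [b [_ WE]] vE indep.
have /choice[u /choice[a ua]] i : exists u, exists a : 'I_p -> R[i],
    v i = u + \sum_(j < p) a j *: b j /\ Z u.
  by have [u [w [-> Zu]]] := vE i; rewrite WE => -[a ->]; exists u, a.
rewrite leqNgt; apply/negP => pn.
pose A := \matrix_(i < n, j < p) a i j.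
have : kermx A != 0.
  rewrite -mxrank_eq0 mxrank_ker subn_eq0 -ltnNge.
  exact: leq_ltn_trans (rank_leq_col A) pn.
move=> /rowV0Pn[x /sub_kermxP xA /rV0Pn[i0 /eqP xi0]]; apply: xi0.
apply: (indep (x 0)).
rewrite (_ : \sum_i _ = \sum_i x 0 i *: u i +
    \sum_i x 0 i *: \sum_(j < p) a i j *: b j).
  rewrite [X in _ + X](_ : _ = 0) ?addr0.
    by apply: subspace_sum => // i _; apply: subspace_scale => //;
      exact: (ua i).2.
  under eq_bigr do rewrite scaler_sumr; rewrite exchange_big big1//= => j _.
  transitivity ((x *m A) 0 j *: b j); last by rewrite xA mxE scale0r.
  by rewrite mxE scaler_suml; apply: eq_bigr => i _; rewrite mxE scalerA.
by rewrite -big_split /=; apply: eq_bigr => i _; rewrite -scalerDr -(ua i).1.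
Qed.

Lemma has_dim_eigenspan (H : lmodType R[i]) n (lam : 'I_n -> R) (v : 'I_n -> H)
    (l : R) :
  linearly_independent v ->
  has_dim
    [set f | exists d : 'I_n -> R[i], f = \sum_(i < n | lam i == l) d i *: v i]
    (count_mem l (codom lam)).
Proof.
move=> ind; pose A := [pred i | lam i == l].
have -> : count_mem l (codom lam) = #|A|.
  by rewrite codomE count_map cardE /enum_mem size_filter filter_predT.
have AE (F : 'I_n -> H) :
    \sum_(i < n | lam i == l) F i = \sum_(j < #|A|) F (enum_val j).
  by rewrite -big_enum_val.
exists (fun j : 'I_#|A| => v (enum_val j)); split.
- move=> c c0 j0.
  pose c' i := if i \in A then c (enum_rank_in (enum_valP j0) i) else 0.
  have := ind c' _ (enum_val j0); rewrite /c' enum_valP enum_valK_in; apply.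
  rewrite -[RHS]c0 (bigID A)/= [X in _ + X]big1 ?addr0 => [|i /negbTE iA].
    by rewrite AE; apply: eq_bigr => j _; rewrite enum_valP enum_valK_in.
  by rewrite inE iA scale0r.
- apply/seteqP; split=> f [d ->]; first by exists (d \o enum_val); rewrite AE.
  (* At most one j contributes to each i; summing avoids inverting [enum_val], which would need an
     element of the fibre. *)
  exists (fun i => \sum_(j < #|A| | enum_val j == i) d j).
  rewrite (partition_big (fun j => enum_val j) (fun i => lam i == l)) => [|j _];
    last by have := enum_valP j.
  by apply: eq_bigr => i _; rewrite scaler_suml; apply: eq_bigr => j /eqP ->.
Qed.

(* A maximal independent family of eigenvectors in the symmetric part of T lists
   each real eigenvalue with its multiplicity. *)
Lemma at_most_real_eigenvalues_sym T (Z W : set (L2 R)) (p : nat) :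
  dissipative T -> is_subspace Z ->
  (forall f g, T (f, g) -> adjoint T (f, g) -> Z f -> Z g) ->
  (forall f (l : R), T (f, l%:C *: f) -> Z f -> f = 0) ->
  has_dim W p ->
  (forall f, Hsym T f -> exists u w, [/\ f = u + w, Z u & W w]) ->
  at_most_real_eigenvalues T p.
Proof.
move=> dT Z_sub inv ucp dimW dec.
have [[[T0 Tlin] _] _ _] := dT.
pose S := T `&` adjoint T.
have S_sub : is_subspace S.
  split; first by split => // x y Txy /=;
    rewrite ![dotL2 0 _]dotL2_conj !dotL2_0r.
  move=> a [f g] [f' g'] [Tfg Afg] [Tfg' Afg']; split; first exact: Tlin.
  move=> x y Txy; have /= e := Afg _ _ Txy; have /= e' := Afg' _ _ Txy.
  by rewrite /= !dotL2_linl e e'.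
have S_Z f g : S (f, g) -> Z f -> Z g by case; exact: inv.
have S_eigen f (l : R) : T (f, l%:C *: f) -> S (f, l%:C *: f).
  by move=> Tf; split => //; exact: dissipative_real_eigen.
have eigen_Z f (l : R) : S (f, l%:C *: f) -> Z f -> f = 0 by case=> Tf _;
    exact: ucp Tf.
(* The empty family qualifies and sizes are bounded by p, so a family of maximal size exists. *)
pose family n := exists (lam : 'I_n -> R) (v : 'I_n -> L2 R),
  (forall i, T (v i, (lam i)%:C *: v i)) /\ linearly_independent v.
have family0 : exists n, `[< family n >].
  exists 0%N; apply/asboolP; exists (fun=> 0), (fun=> 0); split=>
    [[]//|c _ []//].
have family_le n : `[< family n >] -> (n <= p)%N.
  move=> /asboolP[lam [v [Tv ind]]].
  apply: (independent_family_le (v := v) Z_sub dimW) => [i|c Zc].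
    by apply: dec; exists ((lam i)%:C *: v i); split => //;
      exact: dissipative_real_eigen.
  apply: ind; have E := eigen_family_eq0 S_sub Z_sub S_Z eigen_Z
    (fun i => S_eigen _ _ (Tv i)) Zc.
  by rewrite (sum_fibers lam) big1.
have [n /asboolP[lam [v [Tv ind]]] nmax] := ex_maxnP family0 family_le.
have Sv i : S (v i, (lam i)%:C *: v i) by exact: S_eigen.
(* Prepending f to the maximal family, with eigenvalue l, must create a linear relation; the
   coefficient of f in it is nonzero because the [v i] are independent. *)
have span f (l : R) : T (f, l%:C *: f) ->
    exists d, f = \sum_(i < n | lam i == l) d i *: v i.
  move=> Tf.
  pose lam' i := oapp lam l (unlift ord0 i).
  pose v' i := oapp v f (unlift ord0 i).
  have Tv' i : T (v' i, (lam' i)%:C *: v' i).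
    by rewrite /v' /lam'; case: unliftP => [j|] _ /=.
  have v0 : v' ord0 = f by rewrite /v' unlift_none.
  have vS j : v' (lift ord0 j) = v j by rewrite /v' liftK.
  have [c c0 [i ci]] :
      exists2 c, \sum_(i < n.+1) c i *: v' i = 0 & exists i, c i <> 0.
    apply: contrapT => nc; suff /asboolP/nmax : family n.+1 by rewrite ltnn.
    exists lam', v'; split => // c c0 i; apply: contrapT => ci.
    by apply: nc; exists c => //; exists i.
  have cn0 : c ord0 != 0.
    apply/eqP => e; move: c0; rewrite big_ord_recl e scale0r add0r.
    under eq_bigr do rewrite vS.
    move=> /ind cS; apply: ci; case: (unliftP ord0 i) => [j ->|->//].
    exact: cS.
  (* Since 0 lies in [Z], the relation splits over distinct eigenvalues; its part at l expresses f
     through the [v i] with eigenvalue l alone. *)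
  have Z0 : Z (\sum_(i < n.+1) c i *: v' i) by rewrite c0; case: Z_sub.
  have := eigen_family_eq0 S_sub Z_sub S_Z eigen_Z
      (fun i => S_eigen _ _ (Tv' i)) Z0 l.
  rewrite big_mkcond big_ord_recl v0 {1}/lam' unlift_none /= eqxx => fE.
  exists (fun j => - (c ord0)^-1 * c (lift ord0 j)).
  apply: (scalerI cn0); rewrite scaler_sumr; apply/eqP;
    rewrite -subr_eq0 -[X in _ == X]fE.
  apply/eqP; congr (_ + _); rewrite -sumrN big_mkcond; apply: eq_bigr => j _.
  rewrite /lam' liftK /=; case: ifP => // _.
  by rewrite vS scalerA mulrA mulrN divff// mulN1r scaleNr opprK.
exists (codom lam); split.
- by rewrite size_codom card_ord; apply: family_le; apply/asboolP;
  exists lam, v.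
- move=> l; split=> [/codomP[i ->]|[f f0 Tf]].
    exists (v i) => //; apply/eqP => vi0.
    (* Independence with Kronecker coefficients shows that [v i] is nonzero. *)
    have := ind (fun j => (j == i)%:R) _ i; rewrite eqxx => /(_ _)/eqP;
        rewrite oner_eq0.
    move=> sum0; apply: notF; apply: sum0;
      rewrite (bigD1 i)//= eqxx vi0 scaler0 add0r big1// => j /negbTE ->.
    by rewrite scale0r.
  have [d fE] := span f l Tf; apply/negPn/negP => lN; move: f0;
      rewrite fE big_pred0 ?eqxx// => i.
  by apply/negP => /eqP e; rewrite -e codom_f in lN.
- move=> l _; rewrite dissipative_root_space//.
  have := has_dim_eigenspan lam l ind; congr has_dim.
  apply/seteqP; split=> f /= => [[d ->]|]; last exact: span.
  by have [] := eigen_lincomb S_sub d l Sv.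
Qed.

End spectrum.

Theorem theorem5p7 (R : realType) (V : R -> R)
    (V_Linfty : Lfun01 +oo%E V)
    (V_ge0 : ae01 (fun x => 0 <= V x))
    (V_neq0 : ~ ae01 (fun x => V x = 0))
    (Ahat : set (L2 R * L2 R))
    (Ahat_max : max_dissipative Ahat)
    (Ahat_ext :
      op_add (minimal_laplacian R) (op_scale 'i (multiplication V)) `<=` Ahat)
    (Shat : set (L2 R * L2 R))
    (ShatE : Shat = op_restrict (adjoint (minimal_laplacian R)) (op_dom Ahat))
    (Stilde : set (L2 R * L2 R))
    (StildeE : Stilde = op_restrict (adjoint (minimal_laplacian R)) (Hsym Shat))
    (W : set (L2 R)) (W_subspace : is_subspace W) (W_sub : W `<=` Hsym Ahat)
    (W_sum : direct_sum (Hsym Ahat) (op_dom Stilde `&` op_ker (multiplication V)) W)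
    (W_dom : W `&` op_dom Stilde = [set 0])
    (W_ker : W `&` op_ker (multiplication V) = [set 0])
    (p : nat) (dimW : has_dim W p)
    (EV_interior : [set x : R | 0 <= x <= 1 /\ 0 < V x]° !=set0) :
  at_most_real_eigenvalues Ahat p.
Proof.
have [x [e /= e0 xe]] := EV_interior.
have V0 y : x - e < y < x + e -> 0 <= y <= 1 /\ 0 < V y.
  move=> /andP[xy yx]; apply: xe => /=; rewrite ltr_norml; lra.
(* Halving the radius keeps the closed interval [c, d] inside the ball, so its endpoints also lie in
   [0, 1]. *)
pose c := x - e / 2; pose d := x + e / 2.
have cd y : c <= y <= d -> 0 <= y <= 1 /\ 0 < V y.
  by move=> /andP[cy yd]; apply: V0; move: cy yd; rewrite /c /d; lra.
have clt : c < d by rewrite /c /d; lra.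
have [/andP[c0 _] _] : 0 <= c <= 1 /\ 0 < V c by apply: cd; rewrite lexx ltW.
have [/andP[_ d1] _] : 0 <= d <= 1 /\ 0 < V d by apply: cd; rewrite lexx ltW.
have [dA _] := Ahat_max; have [E _] := W_sum.
apply: (at_most_real_eigenvalues_sym dA (vanishes_on_subspace c d)
  (fun f g _ adj => adjoint_vanishes_on V_Linfty Ahat_ext c0 d1 adj) _ dimW).
- move=> f l Tf.
  apply: (eigen_unique_continuation V_Linfty Ahat_ext c0 clt d1 (l := l)).
  exact: dissipative_real_eigen.
- move=> f; rewrite E => -[u [_ Vu0]] [w Ww <-]; exists u, w; split => //.
  (* The component in the kernel of multiplication satisfies V u = 0 almost everywhere, and V > 0
     between c and d. *)
  rewrite /vanishes_on /=; apply: ae01S2 Vu0 (L2fun0 R) =>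
    y /= + z0 /andP[cy yd].
  rewrite z0 => /esym /eqP; rewrite mulf_eq0 => /orP[/eqP[Vy0]|/eqP//].
  by have [|_] := cd y; rewrite ?ltW// Vy0 ltxx.
Qed.
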